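(* Let $S$ be a Gorenstein ring, let $I=(g_1,\dots,g_c)\subset J=(f_1,\dots,f_n)$ be ideals of $S$ such that $g_1,\dots,g_c$ ($c\ge 1$) and $f_1,\dots,f_n$ are regular sequences, and put $R=S/I$, $M=S/J$. Let $\mathbb K$ be the Koszul complex of $f_1,\dots,f_n$ over $S$, let $\mathbb F$ be the (Tate, Eisenbud–Shamash) $R$-free resolution of $M$, and let $\alpha\in\bigwedge^cS^n$ be as described in the context. Let $\phi'$ be the map whose degree $i$ component is the composition $$R\otimes \textstyle\bigwedge^iS^n\longrightarrow R\otimes\bigwedge^{i+c}S^n\;\cong\;\bigl(R\otimes \bigwedge^{n-c-i}S^n\bigr)^*,$$ where the first map is exterior multiplication by $\alpha$ and the second is the isomorphism induced by a choice of isomorphism $\beta:\bigwedge^nS^n\to S$. Let $\pi:\mathbb F\to R\otimes\mathbb K$ be the projection of graded modules with kernel $\bigoplus_{i\ge1}\mathcal D_i(R^c)\otimes \mathbb K$, and let $\phi=\pi^*\circ\phi'\circ\pi$, with components $\phi_i: F_i\to (F_{n-c-i})^*$. Then $\phi$ is a homomorphism of complexes from $\mathbb F$ to the complex having $(F_{n-c-i})^*$ in homological degree $i$ (a shift of $\mathbb F^*=\mathrm{Hom}_R(\mathbb F,R)$), and it maps $M=H_0(\mathbb F)$ isomorphically onto the degree $0$ homology $H^{n-c}(\mathbb F^* )$ of the target. Thus the mapping cone of $\phi$ is a Tate resolution of $M$ over $R$. If moreover $S$ is local with maximal ideal $\mathfrak m$ and $I\subset\mathfrak mJ$, then this Tate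 resolution is minimal.
   Context: All rings are commutative and Noetherian; $(-)^*=\mathrm{Hom}_R(-,R)$ for $R$-modules. Tate resolution: a Tate resolution of a finitely generated module $M$ over a Gorenstein ring $R$ is an exact, doubly infinite complex of finitely generated free $R$-modules that coincides with a free resolution of $M$ in all sufficiently high homological degrees. When $R$ is local with maximal ideal $\mathfrak m_R$ it is minimal if its differential becomes $0$ after tensoring with $R/\mathfrak m_R$. Koszul complex: $\mathbb K$ has terms $\bigwedge^iS^n$; $e'_1,\dots,e'_n$ is a basis of $S^n$ and the differential $\delta$ is the Koszul differential with $\delta(e'_i)=f_i$. The element $\alpha$: choose $a_{i,j}\in S$ with $g_j=\sum_{i=1}^n a_{i,j}f_i$ for $1\le j\le c$, let $e_1,\dots,e_c$ be a basis of $S^c$, and let $A:S^c\to S^n$ be the map with $A(e_j)=\alpha_j:=\sum_i a_{i,j}e'_i$. Then $\alpha=\bigwedge^cA(e_1\wedge\cdots\wedge e_c)=\alpha_1\wedge\cdots\wedge\alpha_c$. The resolution $\mathbb F$: with $\mathcal D_i(R^c)$ the $i$-th divided power of $R^c$, the module $F_k$ is $\bigoplus_{2i+j=k}\mathcal D_i(R^c)\otimes\bigwedge^jR^n$, and the differential of $\mathbb F$ is the sum of $1\otimes\delta:\mathcal D_i(R^c)\otimes\bigwedge^jR^n\to\mathcal D_i(R^c)\otimes\bigwedge^{j-1}R^n$ and the map $\mathcal D_i(R^c)\otimes\bigwedge^jR^n\to\mathcal D_{i-1}(R^c)\otimes\bigwedge^{j+1}R^n$ sending $e_1^{(i_1)}\cdots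 e_c^{(i_c)}\otimes b$ to $\sum_{l:\,i_l\geq 1} e_1^{(i_1)}\cdots e_l^{(i_l-1)}\cdots e_c^{(i_c)}\otimes(\alpha_l\wedge b)$. By a theorem of Tate this is an $R$-free resolution of $M$. Identification by $\beta$: $\bigwedge^{j}R^n\cong(\bigwedge^{n-j}R^n)^*$ via $b\mapsto(b'\mapsto\beta(b\wedge b'))$. Signs: $\phi$ being a homomorphism of complexes is understood up to the usual sign adjustment, i.e. after multiplying each component $\phi_i$ by a suitable sign $\pm1$ depending only on $i$. The mapping cone is formed with these signs; it has $F_i\oplus(F_{n-c-1-i})^*$ in homological degree $i$. Terms with indices out of range are zero. Note that $\pi$ and $\pi^*$ themselves are not maps of complexes. *)

(* Defs.v *)
From HB Require Import structures.
From mathcomp Require Import all_boot all_order all_algebra.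

Set Implicit Arguments.
Unset Strict Implicit.
Unset Printing Implicit Defensive.

Import Order.TTheory GRing.Theory Num.Theory.
Local Open Scope ring_scope.

Definition is_ideal (S : comNzRingType) (I : S -> Prop) : Prop :=
  [/\ I 0, forall x y, I x -> I y -> I (x + y) & forall s x, I x -> I (s * x)].

Definition ideal_gen (S : comNzRingType) (n : nat) (f : 'I_n -> S) : S -> Prop :=
  fun s => exists a : 'I_n -> S, s = \sum_i a i * f i.

Definition ideal_mul (S : comNzRingType) (I J : S -> Prop) : S -> Prop :=
  fun s => exists k (x y : 'I_k -> S),
    [/\ forall i, I (x i), forall i, J (y i) & s = \sum_i x i * y i].

Definition noetherian (S : comNzRingType) : Prop :=
  forall I : S -> Prop, is_ideal I ->
    exists n (f : 'I_n -> S), forall s, I s <-> ideal_gen f s.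

Definition prime_ideal (S : comNzRingType) (P : S -> Prop) : Prop :=
  [/\ is_ideal P, ~ P 1 & forall x y, P (x * y) -> P x \/ P y].

Definition maximal_ideal (S : comNzRingType) (m : S -> Prop) : Prop :=
  [/\ is_ideal m, ~ m 1 &
      forall I : S -> Prop, is_ideal I -> ~ I 1 ->
        (forall s, m s -> I s) -> forall s, I s -> m s].

Definition local_with (S : comNzRingType) (m : S -> Prop) : Prop :=
  maximal_ideal m /\
  forall m' : S -> Prop, maximal_ideal m' -> forall s, m' s <-> m s.

Definition regular_sequence (S : comNzRingType) (n : nat) (f : 'I_n -> S) : Prop :=
  ~ ideal_gen f 1 /\
  forall (i : 'I_n) (s : S),
    (exists a : 'I_n -> S, f i * s = \sum_(k < n | (k < i)%N) a k * f k) ->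
    exists a : 'I_n -> S, s = \sum_(k < n | (k < i)%N) a k * f k.

Definition injective_module (L : comNzRingType) (E : lmodType L) : Prop :=
  forall (A B : lmodType L) (i : {linear A -> B}) (h : {linear A -> E}),
    injective i -> exists h' : {linear B -> E}, forall a, h' (i a) = h a.

Definition finite_injdim (L : comNzRingType) (V : lmodType L) : Prop :=
  exists (d : nat) (E : nat -> lmodType L) (eta : {linear V -> E 0%N})
         (del : forall k, {linear E k -> E k.+1}),
    [/\ forall k, injective_module (E k),
        forall k, (d < k)%N -> forall x : E k, x = 0,
        injective eta,
        forall x : E 0%N, del 0%N x = 0 <-> exists v, eta v = x &
        forall k (x : E k.+1), del k.+1 x = 0 <-> exists y, del k y = x].

(* [L], with structure map [l], is the localization of [S] at the complement of
   [P]; this determines [L] up to a unique isomorphism of [S]-algebras. *)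
Definition is_localization (S L : comNzRingType) (P : S -> Prop)
    (l : {rmorphism S -> L}) : Prop :=
  [/\ forall s, ~ P s -> exists y, l s * y = 1,
      forall x, exists a s, ~ P s /\ x * l s = l a &
      forall a, l a = 0 <-> exists s, ~ P s /\ s * a = 0].

Definition gorenstein (S : comNzRingType) : Prop :=
  noetherian S /\
  forall P : S -> Prop, prime_ideal P ->
    forall (L : comNzRingType) (l : {rmorphism S -> L}),
      is_localization P l -> finite_injdim (L^o : lmodType L).

(* [linfun h] agrees with [h] only if [h] is linear; for each use of [linfun]
   below a lemma checks that this is so. *)
Lemma linfun_linear (R : nzRingType) (V W : vectType R) (h : V -> W) :
  linear h -> forall x, linfun h x = h x.
Proof.
move=> hl x; pose H := GRing.isLinear.Build _ _ _ _ h hl.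
pose h' : {linear V -> W} := HB.pack h H.
exact: (lfunE h' x).
Qed.

(* A [vectType R] over a ring [R] is a module isomorphic to some [R^m]. The
   differential has one component for every pair of degrees, so that no
   transport along equations between integers is needed; [is_complex] says that
   only the components from degree [i] to [i - 1] are nonzero. *)
Record cxdata (R : comNzRingType) := CxData {
  cxob :> int -> vectType R;
  cxd : forall i j, 'Hom(cxob i, cxob j)
}.

Section Complexes.
Variable R : comNzRingType.
Implicit Types C D : cxdata R.

Definition is_complex C : Prop :=
  (forall i j, i != j + 1 -> cxd C i j = 0) /\
  (forall i j k, (cxd C j k \o cxd C i j)%VF = 0).

Definition cycle C (i : int) (x : C i) : Prop := cxd C i (i - 1) x = 0.

Definition boundary C (i : int) (x : C i) : Prop :=
  exists y : C (i + 1), cxd C (i + 1) i y = x.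

Definition exact_at C (i : int) : Prop :=
  forall x : C i, cycle x <-> boundary x.

Definition free_resolution C (M : lmodType R) (eps : {linear C 0 -> M}) : Prop :=
  [/\ is_complex C,
      forall i, i < 0 -> forall x : C i, x = 0,
      forall i, 0 < i -> exact_at C i,
      forall m, exists x, eps x = m &
      forall x, eps x = 0 <-> boundary x].

(* Isomorphism of the truncations in degrees [>= N]. *)
Definition iso_from (N : int) C D : Prop :=
  exists th : forall i, 'Hom(C i, D i),
    (forall i, N <= i -> bijective (th i)) /\
    (forall i, N < i ->
       (cxd D i (i - 1) \o th i = th (i - 1) \o cxd C i (i - 1))%VF).

Definition tate_resolution C (M : lmodType R) : Prop :=
  [/\ is_complex C, forall i, exact_at C i &
      exists (G : cxdata R) (eps : {linear G 0 -> M}) (N : int),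
        free_resolution eps /\ iso_from N C G].

(* The differentials of [C (x) R/m] vanish: [d C_i] lies in [m C_{i-1}]. *)
Definition minimal_complex (m : R -> Prop) C : Prop :=
  forall i (x : C i), exists k (r : 'I_k -> R) (v : 'I_k -> C (i - 1)),
    (forall l, m (r l)) /\ cxd C i (i - 1) x = \sum_l r l *: v l.

(* Bidegree components again avoid transports: a map of degree 0 has zero
   components off the diagonal. *)
Definition chain_map C D (psi : forall i j, 'Hom(C i, D j)) : Prop :=
  [/\ is_complex C, is_complex D,
      forall i j, i != j -> psi i j = 0 &
      forall i, (cxd D i (i - 1) \o psi i i
                 = psi (i - 1) (i - 1) \o cxd C i (i - 1))%VF].

(* [psi], a chain map, induces an isomorphism [H_i(C) -> H_i(D)]. *)
Definition iso_on_homology C D (psi : forall i j, 'Hom(C i, D j)) (i : int) : Prop :=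
  (forall x : C i, cycle x -> boundary (psi i i x) -> boundary x) /\
  (forall y : D i, cycle y -> exists x : C i, cycle x /\ boundary (y - psi i i x)).

Definition dual (V : vectType R) : vectType R := 'Hom(V, R^o).

Definition dual_map (V W : vectType R) (h : 'Hom(V, W)) : 'Hom(dual W, dual V) :=
  linfun (fun u : dual W => (u \o h)%VF : dual V).

Lemma dual_mapE (V W : vectType R) (h : 'Hom(V, W)) (u : dual W) (x : V) :
  (dual_map h u : 'Hom(V, R^o)) x = (u : 'Hom(W, R^o)) (h x).
Proof.
rewrite /dual_map linfun_linear ?comp_lfunE // => k v w.
by rewrite comp_lfunDl comp_lfunZl.
Qed.

(* [(C_{N - i})^*] in homological degree [i]. *)
Definition dual_shift C (N : int) : cxdata R :=
  @CxData R (fun i => dual (C (N - i)))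
            (fun i j => dual_map (cxd C (N - j) (N - i))).

Definition dsum (V W : vectType R) : vectType R := (V * W)%type.

Definition cone_map (V W V' W' : vectType R) (dV : 'Hom(V, V'))
    (psi : 'Hom(V, W')) (dW : 'Hom(W, W')) :
    'Hom(dsum V W, dsum V' W') :=
  linfun (fun x : dsum V W => (dV x.1, psi x.1 - dW x.2) : dsum V' W').

Lemma cone_mapE (V W V' W' : vectType R) (dV : 'Hom(V, V'))
    (psi : 'Hom(V, W')) (dW : 'Hom(W, W')) (x : V) (y : W) :
  cone_map dV psi dW ((x, y) : dsum V W) = (dV x, psi x - dW y).
Proof.
rewrite /cone_map linfun_linear // => k [v w] [v' w'] /=.
have -> : dV (k *: v + v') = k *: dV v + dV v' by rewrite linearP.
have -> : psi (k *: v + v') = k *: psi v + psi v' by rewrite linearP.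
have -> : dW (k *: w + w') = k *: dW w + dW w' by rewrite linearP.
by congr pair => /=; rewrite scalerBr opprD addrACA.
Qed.

(* Indexed so that degree [i] is [C_i (+) D_{i+1}]. *)
Definition cone C D (psi : forall i j, 'Hom(C i, D j)) : cxdata R :=
  @CxData R (fun i => dsum (C i) (D (i + 1)))
            (fun i j => cone_map (cxd C i j) (psi i (j + 1))
                                 (cxd D (i + 1) (j + 1))).

End Complexes.

Section Exterior.
Variables (R : comNzRingType) (n : nat).

(* The whole exterior algebra of [R^n]: [x A] is the coefficient of
   [e'_{a_1} ^ ... ^ e'_{a_j}], where [A = {a_1 < ... < a_j}]. *)
Definition ext : vectType R := {ffun {set 'I_n} -> R^o}.

Definition inversions (A B : {set 'I_n}) : nat :=
  #|[set u : 'I_n * 'I_n | [&& u.1 \in A, u.2 \in B & (u.2 < u.1)%N]]|.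

(* [e'_A ^ e'_B] is [(-1)^(inversions A B) e'_(A u B)] if [A] and [B] are
   disjoint, and 0 otherwise. *)
Definition wedge (x y : ext) : ext :=
  [ffun C : {set 'I_n} =>
     \sum_(A : {set 'I_n} | A \subset C)
        (-1) ^+ inversions A (C :\: A) * (x A * y (C :\: A))].

Definition ext1 : ext := [ffun A => (A == set0)%:R].

Definition ext_vec (v : 'I_n -> R) : ext :=
  [ffun A => \sum_i v i * (A == [set i])%:R].

(* [e'_A] goes to the sum over [i \in A] of
   [(-1)^#{k \in A | k < i} f_i e'_(A \ i)]. *)
Definition koszul_diff (f : 'I_n -> R) (x : ext) : ext :=
  [ffun B : {set 'I_n} =>
     \sum_(i | i \notin B)
        (-1) ^+ #|[set k in B | (k < i)%N]| * (f i * x (i |: B))].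

(* Basis elements of degree [j]; there are none if [j < 0] or [j > n]. *)
Definition ext_basis (j : int) : finType :=
  {A : {set 'I_n} | #|A|%:Z == j}.

Definition extpow (j : int) : vectType R := {ffun ext_basis j -> R^o}.

Definition ext_in (j : int) (x : extpow j) : ext :=
  [ffun A => \sum_(b : ext_basis j | val b == A) x b].

Definition ext_pr (j : int) (y : ext) : extpow j := [ffun b => y (val b)].

Definition koszul (f : 'I_n -> R) : cxdata R :=
  @CxData R extpow
    (fun i j => linfun (fun x : extpow i => ext_pr j (koszul_diff f (ext_in x)))).

Lemma ext_in_linear j : linear (@ext_in j).
Proof.
move=> k x y; apply/ffunP => A; rewrite !ffunE scaler_sumr -big_split.
by apply: eq_bigr => b _; rewrite !ffunE.
Qed.

Lemma ext_pr_linear j : linear (ext_pr j).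
Proof. by move=> k x y; apply/ffunP => b; rewrite !ffunE. Qed.

Lemma wedge_linearr x : linear (wedge x).
Proof.
move=> k y z; apply/ffunP => A; rewrite !ffunE scaler_sumr -big_split.
apply: eq_bigr => B _; rewrite !ffunE /= /GRing.scale /= !mulrDr.
by rewrite !(mulrCA k).
Qed.

Lemma wedge_linearl y : linear (wedge^~ y).
Proof.
move=> k x z; apply/ffunP => A; rewrite !ffunE scaler_sumr -big_split.
apply: eq_bigr => B _; rewrite !ffunE /= /GRing.scale /= mulrDl mulrDr.
by congr (_ + _); rewrite -mulrA mulrCA.
Qed.

Lemma koszul_diff_linear f : linear (koszul_diff f).
Proof.
move=> k x y; apply/ffunP => A; rewrite !ffunE scaler_sumr -big_split.
apply: eq_bigr => i _; rewrite !ffunE /= /GRing.scale /= !mulrDr.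
by rewrite !(mulrCA k).
Qed.

Lemma koszulE f i j (x : extpow i) :
  cxd (koszul f) i j x = ext_pr j (koszul_diff f (ext_in x)).
Proof.
rewrite /= linfun_linear // => k y z.
by rewrite ext_in_linear koszul_diff_linear ext_pr_linear.
Qed.

End Exterior.

Section Resolution.
Variables (R : comNzRingType) (c n : nat).

(* [(a, A)] stands for the basis element [e^(a) (x) e'_A] of
   [D_|a|(R^c) (x) /\^#|A| R^n], of degree [2|a| + #|A|]. The exponents [a l]
   are bounded by the degree, whence the bound making this type finite. *)
Definition res_basis (k : int) : finType :=
  {b : {ffun 'I_c -> 'I_(absz k).+1} * {set 'I_n} |
    (2 * (\sum_l b.1 l) + #|b.2|)%N%:Z == k}.

Definition res_exp (k : int) (b : res_basis k) : {ffun 'I_c -> nat} :=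
  [ffun l => nat_of_ord ((val b).1 l)].

Definition res_set (k : int) (b : res_basis k) : {set 'I_n} := (val b).2.

Definition res_ob (k : int) : vectType R := {ffun res_basis k -> R^o}.

(* The [y] in [/\R^n] such that [e^(a) (x) y] is the component of [x] at [e^(a)]. *)
Definition res_comp (k : int) (a : {ffun 'I_c -> nat}) (x : res_ob k) : ext R n :=
  [ffun A => \sum_(b : res_basis k | (res_exp b == a) && (res_set b == A)) x b].

Definition exp_succ (a : {ffun 'I_c -> nat}) (l : 'I_c) : {ffun 'I_c -> nat} :=
  [ffun l' => (a l' + (l' == l))%N].

(* The component of [d x] at [e^(a)] receives [delta] of the component of [x] at
   [e^(a)], and [alpha_l] times its component at [e^(a + 1_l)] for every [l]. *)
Definition res_diff (f : 'I_n -> R) (al : 'I_c -> ext R n) (i j : int)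
    (x : res_ob i) : res_ob j :=
  [ffun b : res_basis j =>
     (koszul_diff f (res_comp (res_exp b) x)
      + \sum_l wedge (al l) (res_comp (exp_succ (res_exp b) l) x)) (res_set b)].

Definition tate_shamash (f : 'I_n -> R) (al : 'I_c -> ext R n) : cxdata R :=
  @CxData R res_ob (fun i j => linfun (@res_diff f al i j)).

(* Projection of graded modules onto the summand [D_0 (x) /\^k R^n]. *)
Definition res_proj (k : int) : 'Hom(res_ob k, extpow R n k) :=
  linfun (fun x : res_ob k => ext_pr k (res_comp [ffun=> 0%N] x)).

Lemma res_comp_linear k a : linear (@res_comp k a).
Proof.
move=> r x y; apply/ffunP => A; rewrite !ffunE scaler_sumr -big_split.
by apply: eq_bigr => b _; rewrite !ffunE.
Qed.

Lemma tate_shamashE f al i j (x : res_ob i) :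
  cxd (tate_shamash f al) i j x = res_diff f al j x.
Proof.
rewrite /= linfun_linear // => k y z; apply/ffunP => b.
pose D (u : res_ob i) := koszul_diff f (res_comp (res_exp b) u) +
  \sum_l wedge (al l) (res_comp (exp_succ (res_exp b) l) u).
have E (u : res_ob i) : res_diff f al j u b = D u (res_set b) by rewrite ffunE.
have DL : D (k *: y + z) = k *: D y + D z.
  rewrite /D res_comp_linear koszul_diff_linear scalerDr addrACA.
  rewrite scaler_sumr -big_split; congr (_ + _).
  by apply: eq_bigr => l _; rewrite res_comp_linear wedge_linearr.
by rewrite E DL [LHS]ffunE [X in X + _]ffunE [RHS]ffunE [in RHS]ffunE !E.
Qed.

Lemma res_projE k (x : res_ob k) :
  res_proj k x = ext_pr k (res_comp [ffun=> 0%N] x).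
Proof.
rewrite /res_proj linfun_linear // => r y z.
by rewrite res_comp_linear ext_pr_linear.
Qed.

End Resolution.

Section Comparison.
Variables (S R : comNzRingType) (p : {rmorphism S -> R}) (c n : nat).

Definition ext_map (x : ext S n) : ext R n := [ffun A => p (x A)].

Definition alpha_vec (a : 'M[S]_(n, c)) (j : 'I_c) : ext S n :=
  ext_vec (fun i => a i j).

Definition alpha (a : 'M[S]_(n, c)) : ext S n :=
  \big[@wedge S n/@ext1 S n]_(j < c) alpha_vec a j.

Definition tate_shamash_quot (f : 'I_n -> S) (a : 'M[S]_(n, c)) : cxdata R :=
  tate_shamash (fun i => p (f i)) (fun l => ext_map (alpha_vec a l)).

(* [R (x) beta : /\^n R^n -> R]. *)
Definition form_map (beta : 'Hom(extpow S n n%:Z, S^o)) :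
    'Hom(extpow R n n%:Z, R^o) :=
  linfun (fun y : extpow R n n%:Z =>
    \sum_b y b * p (beta [ffun b' => (b' == b)%:R]) : R^o).

Lemma form_mapE beta (y : extpow R n n%:Z) :
  form_map beta y = \sum_b y b * p (beta [ffun b' => (b' == b)%:R]).
Proof.
rewrite /form_map linfun_linear // => k u v.
rewrite scaler_sumr -big_split; apply: eq_bigr => b _.
by rewrite !ffunE mulrDl /GRing.scale /= mulrA.
Qed.

(* [b |-> (b' |-> beta (alpha ^ b ^ b'))]; zero unless [c + i + j = n]. *)
Definition phi' (beta : 'Hom(extpow S n n%:Z, S^o)) (al : ext S n) (i j : int) :
    'Hom(extpow R n i, dual (extpow R n j)) :=
  linfun (fun b : extpow R n i =>
    linfun (fun b' : extpow R n j =>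
      form_map beta
        (ext_pr n%:Z (wedge (wedge (ext_map al) (ext_in b)) (ext_in b')))
      : R^o) : dual (extpow R n j)).

Lemma phi'E beta al i j (b : extpow R n i) (b' : extpow R n j) :
  (phi' beta al i j b : 'Hom(extpow R n j, R^o)) b' =
  form_map beta
    (ext_pr n%:Z (wedge (wedge (ext_map al) (ext_in b)) (ext_in b'))).
Proof.
have lin2 (x : extpow R n i) : linear (fun y : extpow R n j => form_map beta
    (ext_pr n%:Z (wedge (wedge (ext_map al) (ext_in x)) (ext_in y))) : R^o).
  by move=> k y z; rewrite ext_in_linear wedge_linearr ext_pr_linear linearP.
rewrite /phi' linfun_linear; first by rewrite linfun_linear.
move=> k x y; apply/lfunP => z.
rewrite add_lfunE scale_lfunE !(linfun_linear (lin2 _)).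
by rewrite ext_in_linear wedge_linearr wedge_linearl ext_pr_linear linearP.
Qed.

Definition phi (f : 'I_n -> S) (a : 'M[S]_(n, c))
    (beta : 'Hom(extpow S n n%:Z, S^o)) (i j : int) :
    'Hom(tate_shamash_quot f a i,
         dual_shift (tate_shamash_quot f a) (n%:Z - c%:Z) j) :=
  (dual_map (res_proj R c n (n%:Z - c%:Z - j))
     \o (phi' beta (alpha a) i (n%:Z - c%:Z - j) \o res_proj R c n i))%VF.

End Comparison.

(* Main.v *)
Require Import Defs.
From HB Require Import structures.
From mathcomp Require Import all_boot all_order all_algebra.
From mathcomp Require Import boolp functions.
From mathcomp Require classical_sets.
From mathcomp Require Import zify ring.

Set Implicit Arguments.
Unset Strict Implicit.
Unset Printing Implicit Defensive.

Import Order.TTheory GRing.Theory Num.Theory.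
Local Open Scope ring_scope.

(** Write [R_k = S/(g_1, ..., g_k)]. Exterior multiplication by [alpha_l] is a
    null-homotopy of multiplication by [g_l] on the Koszul complex of [f], since
    [delta alpha_l = g_l]. If [C] is a complex over [R_k], [g] is a nonzerodivisor
    on [C], and [al] is a homotopy with [d al + al d = g] and [al al = 0], then
    [d + t al] is a differential on [C/g] with an additional variable [t]. The
    variable can act on divided powers, lowering exponents, or on power series,
    raising them. If the homology of [C] is generated by one cycle [w], with the
    only relations those coming from [J], then the same holds after the step: the
    new generator is [w] in the first case and [al w] in the second. The reason is
    an elementary diagram chase: if [d x = g y] then [y] is a cycle and [x - al y]
    is a cycle, so that modulo [g] one has [x = s al w + r w + boundary], and the
    term [r w] is a boundary of [C] as soon as [al x] is a boundary modulo [g].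

    Starting from the Koszul complex of the regular sequence [f] and using
    [g_1, ..., g_c] one after the other, the first variant yields the resolution
    [F] of [M] ([cycles_lift_all] with divided powers, [res_exact]). The second
    variant is applied to the dual Koszul complex, which is isomorphic to the
    Koszul complex by [star]; on it the homotopies are the interior products with
    the [alpha_l]. It yields the dual of [F], whose homology is therefore [M],
    generated by the functional [b |-> (alpha /\ b)_top] ([dual_shift_cycle],
    [dual_augment]). Up to a unit this functional is the image of [1] under [phi],
    so [phi] is a quasi-isomorphism once it is a chain map, and its cone is exact
    ([cone_exact]). In high degrees the dual vanishes and the cone is [F].

    That [phi] is a chain map up to sign follows from [alpha_l /\ alpha = 0], from
    [delta alpha = 0] over [R], and from the Leibniz rule, because a Koszul
    boundary has no component in [/\^n].

    For minimality, the coefficients of a relation between the elements of a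
    regular sequence lie in the ideal that it generates, so [g_j] in [mJ] forces
    all [a_ij] into [m]. The entries of the differential of the cone are then sums
    of terms with a factor [f_i] or [a_ij]; in [phi] because [c >= 1]. *)

(** * Linear identities in modules *)

(** Syntax of linear combinations; a variable is a position in a list of
    vectors. *)
Inductive lexp (S : Type) :=
  LVar of nat | LZero | LAdd of lexp S & lexp S | LOpp of lexp S
| LScale of S & lexp S.
Arguments LVar {S}.
Arguments LZero {S}.

Section LinearIdentities.
Variables (S : comNzRingType) (V : lmodType S).

Fixpoint lval (env : seq V) (e : lexp S) : V :=
  match e with
  | LVar i => nth 0 env i
  | LZero => 0
  | LAdd a b => lval env a + lval env b
  | LOpp a => - lval env a
  | LScale k a => k *: lval env a
  end.

Fixpoint lcoef (e : lexp S) (i : nat) : S :=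
  match e with
  | LVar j => if Nat.eqb i j then 1 else 0
  | LZero => 0
  | LAdd a b => lcoef a i + lcoef b i
  | LOpp a => - lcoef a i
  | LScale k a => k * lcoef a i
  end.

Lemma lval_coef env e :
  lval env e = \sum_(i < size env) lcoef e i *: nth 0 env i.
Proof.
elim: e => /= [j||a -> b ->|a ->|k a ->].
- have E i : Nat.eqb i j = (i == j) by elim: i j => [|i IH] [|j].
  have [sj|js] := leqP (size env) j.
    rewrite nth_default // big1 // => i _; rewrite E.
    by rewrite ltn_eqF ?scale0r //; apply: leq_trans sj.
  rewrite (bigD1 (Ordinal js)) //= E eqxx scale1r big1 ?addr0 // => i ij.
  by rewrite E; move: ij; rewrite -val_eqE /= => /negPf->; rewrite scale0r.
- by rewrite big1 // => i _; rewrite scale0r.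
- by rewrite -big_split; apply: eq_bigr => i _; rewrite scalerDl.
- by rewrite -sumrN; apply: eq_bigr => i _; rewrite scaleNr.
- by rewrite scaler_sumr; apply: eq_bigr => i _; rewrite scalerA.
Qed.

Fixpoint same_coefs (k : nat) (e1 e2 : lexp S) : Prop :=
  if k is k'.+1 then lcoef e1 k' = lcoef e2 k' /\ same_coefs k' e1 e2 else True.

(** Reduces identities in a module to identities in the ring of scalars. *)
Lemma lval_eq env e1 e2 :
  same_coefs (size env) e1 e2 -> lval env e1 = lval env e2.
Proof.
rewrite !lval_coef => E; apply: eq_bigr => i _; congr (_ *: _).
elim: (size env) E (nat_of_ord i) (ltn_ord i) => //= m IH [Em E] j.
by rewrite ltnS leq_eqVlt => /orP[/eqP->//|]; apply: IH.
Qed.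
End LinearIdentities.

(* Occurrences of one vector may differ in their implicit structures, so atoms
   are compared up to conversion; comparing the last arguments first keeps this
   from unfolding unrelated terms. *)
Ltac lm_same x y :=
  first
  [ constr_eq x y
  | lazymatch x with
    | ?f ?a => lazymatch y with ?h ?b => lm_same a b; unify x y end
    | (fun _ => _) => lazymatch y with (fun _ => _) => unify x y end
    end ].
Ltac lm_mem x l :=
  lazymatch l with
  | nil => constr:(false)
  | cons ?y ?l' =>
    match goal with
    | _ => let _ := match goal with _ => lm_same x y end in constr:(true)
    | _ => lm_mem x l'
    end
  end.
Ltac lm_atoms t l :=
  lazymatch t with
  | (?a + ?b)%R => let l1 := lm_atoms a l in lm_atoms b l1
  | (- ?a)%R => lm_atoms a l
  | (?k *: ?a)%R => lm_atoms a l
  | (0)%R => l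
  | _ => let m := lm_mem t l in
         lazymatch m with true => l | false => constr:(cons t l) end
  end.
Ltac lm_index x l :=
  lazymatch l with
  | cons ?y ?l' =>
    match goal with
    | _ => let _ := match goal with _ => lm_same x y end in constr:(0%N)
    | _ => let i := lm_index x l' in constr:(S i)
    end
  end.
Ltac lm_quote R t l :=
  lazymatch t with
  | (?a + ?b)%R => let x := lm_quote R a l in let y := lm_quote R b l in
                   constr:(@LAdd R x y)
  | (- ?a)%R => let x := lm_quote R a l in constr:(@LOpp R x)
  | (?k *: ?a)%R => let x := lm_quote R a l in constr:(@LScale R k x)
  | (0)%R => constr:(@LZero R)
  | _ => let i := lm_index t l in constr:(@LVar R i)
  end.

(** Applying [same_vectorE] makes the scalars and the module structure explicit in
    the goal, where the tactic below can read them. *)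
Definition same_vector (S : comNzRingType) (V : lmodType S) (x y : V) := x = y.

Lemma same_vectorE (S : comNzRingType) (V : lmodType S) (x y : V) :
  same_vector x y -> x = y.
Proof. by []. Qed.

Ltac linear_identity :=
  apply: same_vectorE;
  lazymatch goal with
  | |- @same_vector ?R ?V ?x ?y =>
    let l0 := lm_atoms x (@nil V) in
    let l := lm_atoms y l0 in
    let e1 := lm_quote R x l in
    let e2 := lm_quote R y l in
    refine (@lval_eq R V l e1 e2 _);
    cbv [same_coefs lcoef size Nat.eqb]; repeat split; ring
  end.

(** * The exterior algebra *)

Lemma sum_antisym0 (V : zmodType) (I : finType) (A : I -> I -> V) :
  (forall i, A i i = 0) -> (forall i j, A i j = - A j i) ->
  \sum_i \sum_j A i j = 0.
Proof.
move=> A0 AN.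
have E i : \sum_j A i j = \sum_(j | (enum_rank i < enum_rank j)%N) A i j
                        + \sum_(j | (enum_rank j < enum_rank i)%N) A i j.
  rewrite (bigID (fun j => (enum_rank i < enum_rank j)%N)) /=; congr (_ + _).
  rewrite (bigD1 i) ?ltnn //= A0 add0r; apply: eq_bigl => j.
  by rewrite -leqNgt ltn_neqAle -(inj_eq (@enum_rank_inj I)) andbC.
under eq_bigr do rewrite E.
rewrite big_split /= [X in _ + X](exchange_big_dep xpredT) //= -big_split /=.
apply: big1 => i _; rewrite -big_split /=; apply: big1 => j _.
by rewrite AN addNr.
Qed.

Section ExteriorAlgebra.
Variables (R : comNzRingType) (n : nat).
Implicit Types (u v : 'I_n -> R) (x y z : ext R n) (A B C : {set 'I_n}).

Definition vec_wedge v x : ext R n := wedge (ext_vec v) x.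

Definition nb_below A (i : 'I_n) : nat := #|[set k in A | (k < i)%N]|.

Lemma nb_belowE A i : nb_below A i = (\sum_(k in A) (k < i)%N)%N.
Proof.
rewrite /nb_below -sum1_card big_mkcond [RHS]big_mkcond; apply: eq_bigr => k _.
by rewrite inE; case: (k \in A).
Qed.

Lemma inversionsE A B : inversions A B = (\sum_(i in A) nb_below B i)%N.
Proof.
rewrite /inversions -sum1_card big_mkcond /=.
under [RHS]eq_bigr do rewrite nb_belowE.
rewrite pair_big [RHS]big_mkcond /=; apply: eq_bigr => -[i j] _.
by rewrite inE /=; case: (i \in A); case: (j \in B).
Qed.

Lemma nb_belowU A i j : j \notin A ->
  nb_below (j |: A) i = ((j < i) + nb_below A i)%N.
Proof. by move=> jA; rewrite !nb_belowE big_setU1. Qed.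

Lemma nb_belowD A i j : j \in A ->
  nb_below A i = ((j < i) + nb_below (A :\ j) i)%N.
Proof. by move=> jA; rewrite -{1}(setD1K jA) nb_belowU // !inE eqxx. Qed.

Lemma vec_wedgeE v x C :
  vec_wedge v x C =
  \sum_(i in C) (-1) ^+ nb_below C i * (v i * x (C :\ i)).
Proof.
rewrite /vec_wedge ffunE.
under eq_bigr do rewrite ffunE mulr_suml mulr_sumr.
rewrite exchange_big [RHS]big_mkcond /=; apply: eq_bigr => i _.
case: ifPn => iC.
  rewrite (bigD1 [set i]) ?sub1set //= big1 => [|A /andP[_ /negPf->]]; last first.
    by rewrite mulr0 mul0r mulr0.
  rewrite addr0 eqxx mulr1 inversionsE big_set1.
  by rewrite (nb_belowD _ iC) ltnn add0n.
apply: big1 => A AC; case: eqP => [E|_]; last by rewrite mulr0 mul0r mulr0.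
by move: AC iC; rewrite E sub1set => ->.
Qed.

Lemma koszul_diffE v x B :
  koszul_diff v x B =
  \sum_(i | i \notin B) (-1) ^+ nb_below B i * (v i * x (i |: B)).
Proof. by rewrite ffunE. Qed.

Lemma vec_wedge_linear v : linear (vec_wedge v).
Proof. exact: wedge_linearr. Qed.
HB.instance Definition _ v :=
  GRing.isLinear.Build R _ _ _ (vec_wedge v) (vec_wedge_linear v).
HB.instance Definition _ v :=
  GRing.isLinear.Build R _ _ _ (@koszul_diff R n v) (koszul_diff_linear v).

Lemma koszul_diffK v x : koszul_diff v (koszul_diff v x) = 0.
Proof.
apply/ffunP => B; rewrite koszul_diffE [RHS]ffunE.
pose T i j : R := if [&& i \notin B, j \notin B & i != j] then
   (-1) ^+ (nb_below B i + nb_below (i |: B) j) *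
     (v i * v j * x (j |: (i |: B))) else 0.
transitivity (\sum_i \sum_j T i j).
  rewrite big_mkcond; apply: eq_bigr => i _; rewrite /T.
  case: ifPn => iB /=; last by rewrite big1.
  rewrite koszul_diffE mulrA mulr_sumr big_mkcond; apply: eq_bigr => j _.
  rewrite !inE negb_or eq_sym andbC; case: ifP => // _.
  by rewrite exprD; ring.
apply: sum_antisym0 => [i|i j]; rewrite /T ?eqxx ?andbF // (eq_sym j).
case: (boolP (i \in B)) => iB /=; first by rewrite andbF oppr0.
case: (boolP (j \in B)) => jB /=; first by rewrite oppr0.
case: eqVneq => [//|ij]; first by rewrite oppr0.
rewrite !nb_belowU // (setUCA [set j]) (mulrC (v j)) !exprD.
case: (ltngtP i j) => [_|_|/val_inj E] /=; rewrite ?expr1 ?expr0; [ring|ring|].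
by rewrite E eqxx in ij.
Qed.

(** The Clifford relation. In both composites the terms with [i = j] add up to
    the right-hand side, and the others cancel in pairs. It makes exterior
    multiplication by [alpha_l] a homotopy for [g_l]. *)
Lemma koszul_diff_vec_wedge v u x :
  koszul_diff v (vec_wedge u x) + vec_wedge u (koszul_diff v x)
  = (\sum_i u i * v i) *: x.
Proof.
apply/ffunP => B; rewrite ffunE koszul_diffE vec_wedgeE [RHS]ffunE.
pose T i j : R :=  (-1) ^+ (nb_below B i + nb_below (i |: B) j) *
     (v i * u j * x ((i |: B) :\ j)).
have -> : \sum_(i | i \notin B)
     (-1) ^+ nb_below B i * (v i * vec_wedge u x (i |: B)) =
   \sum_(i | i \notin B) u i * v i * x B + \sum_(i | i \notin B) \sum_(j in B) T i j.
  rewrite -big_split; apply: eq_bigr => i iB /=.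
  rewrite vec_wedgeE (bigD1 i) ?setU11 //= mulrDr mulrDr; congr (_ + _).
    rewrite nb_belowU // ltnn add0n setU1K // (mulrCA (v i)) signrMK.
    by rewrite mulrA (mulrC (v i)).
  rewrite mulrA mulr_sumr; apply: eq_big => [j|j jB].
    by rewrite !inE; case: eqVneq => [->|_]; rewrite ?(negPf iB) ?andbT.
  by rewrite /T exprD; ring.
have -> : \sum_(i in B) (-1) ^+ nb_below B i * (u i * koszul_diff v x (B :\ i)) =
   \sum_(i in B) u i * v i * x B - \sum_(i in B) \sum_(j | j \notin B) T j i.
  rewrite -sumrN -big_split; apply: eq_bigr => i iB /=.
  rewrite koszul_diffE (bigD1 i) /=; last by rewrite !inE eqxx.
  rewrite mulrDr mulrDr; congr (_ + _).
    rewrite (nb_belowD _ iB) ltnn add0n setD1K //.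
    by rewrite (mulrCA (u i)) signrMK mulrA.
  rewrite mulrA mulr_sumr -sumrN; apply: eq_big => [j|j /andP[]].
    rewrite !inE negb_and negbK; case: eqVneq => //= [->|]; last by rewrite andbT.
    by rewrite iB.
  rewrite !inE negb_and negbK => /orP[/eqP->|jB ij]; first by rewrite eqxx.
  have -> : j |: B :\ i = (j |: B) :\ i.
    apply/setP => k; rewrite !inE; case: (eqVneq k j) => [->|//].
    by rewrite ij.
  rewrite /T nb_belowU // [in RHS](nb_belowD j iB).
  rewrite !exprD; case: (ltngtP i j) => [_|_|/val_inj E] /=;
    rewrite ?expr1 ?expr0; [ring|ring|].
  by rewrite E eqxx in ij.
rewrite [X in _ - X]exchange_big addrACA subrr addr0 addrC.
rewrite -(bigID (fun i => i \in B) xpredT (fun i => u i * v i * x B)) /=.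
by rewrite -mulr_suml.
Qed.

Lemma koszul_diffDl v u x :
  koszul_diff (fun i => v i + u i) x = koszul_diff v x + koszul_diff u x.
Proof.
apply/ffunP => B; rewrite [RHS]ffunE !koszul_diffE -big_split; apply: eq_bigr => i _.
by rewrite mulrDl mulrDr.
Qed.

(** Polarization of [koszul_diffK]. *)
Lemma koszul_diff_anti v u x :
  koszul_diff v (koszul_diff u x) = - koszul_diff u (koszul_diff v x).
Proof.
have := koszul_diffK (fun i => v i + u i) x.
rewrite !koszul_diffDl !linearD /= !koszul_diffK add0r addr0 => /eqP.
by rewrite addr_eq0 => /eqP.
Qed.

(** The Hodge star. Its sign makes it conjugate exterior to interior products
    exactly, see [star_vec_wedge], so that the dual of a Koszul complex needs no
    separate study. *)
Definition star x : ext R n :=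
  [ffun B : {set 'I_n} => (-1) ^+ (\sum_(i in ~: B) i)%N * x (~: B)].

Definition unstar x : ext R n :=
  [ffun B : {set 'I_n} => (-1) ^+ (\sum_(i in B) i)%N * x (~: B)].

Lemma starK : cancel star unstar.
Proof.
by move=> x; apply/ffunP => B; rewrite !ffunE setCK signrMK.
Qed.

Lemma unstarK : cancel unstar star.
Proof.
by move=> x; apply/ffunP => B; rewrite !ffunE setCK signrMK.
Qed.

Lemma star_linear : linear star.
Proof.
move=> k x y; apply/ffunP => B; rewrite !ffunE /GRing.scale /=; ring.
Qed.
HB.instance Definition _ := GRing.isLinear.Build R _ _ _ star star_linear.

Lemma unstar_linear : linear unstar.
Proof.
move=> k x y; apply/ffunP => B; rewrite !ffunE /GRing.scale /=; ring.
Qed.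
HB.instance Definition _ := GRing.isLinear.Build R _ _ _ unstar unstar_linear.

Lemma nb_belowC A i : (nb_below A i + nb_below (~: A) i)%N = i.
Proof.
rewrite !nb_belowE; under [X in (_ + X)%N]eq_bigl do rewrite inE.
rewrite -(bigID (fun k => k \in A) xpredT (fun k : 'I_n => (k < i)%N : nat)) /=.
transitivity (\sum_(k < i) 1)%N; last by rewrite sum1_card card_ord.
rewrite (big_ord_widen n (fun=> 1%N)) ?[RHS]big_mkcond //; last exact: ltnW.
Qed.

(** The sign of [star] changes by [(-1)^i] when [i] joins the set, which is the
    product of the signs of [i] relative to [B] and to its complement. *)
Lemma star_vec_wedge v x : star (vec_wedge v x) = koszul_diff v (star x).
Proof.
apply/ffunP => B; rewrite ffunE vec_wedgeE koszul_diffE mulr_sumr.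
apply: eq_big => [i|i]; rewrite inE // => iB.
have -> : ~: B :\ i = ~: (i |: B) by apply/setP => j; rewrite !inE negb_or.
rewrite ffunE setCU (bigD1 i) /=; last by rewrite inE.
rewrite -(nb_belowC B i) !exprD.
rewrite (eq_bigl (fun j => j \in [set~ i] :&: ~: B)); last first.
  by move=> j; rewrite !inE andbC.
set b := (-1) ^+ nb_below B i; set e := (-1) ^+ nb_below (~: B) i.
set t := (-1) ^+ (\sum_(_ | _) _)%N; set X := x _.
transitivity (e * (e * (b * (v i * (t * X))))); last by rewrite /e signrMK.
ring.
Qed.

Lemma unstar_koszul_diff v x : unstar (koszul_diff v x) = vec_wedge v (unstar x).
Proof. by rewrite -{1}(unstarK x) -star_vec_wedge starK. Qed.

Lemma vec_wedge_anti v u x :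
  vec_wedge v (vec_wedge u x) = - vec_wedge u (vec_wedge v x).
Proof.
by apply: (can_inj starK); rewrite linearN /= !star_vec_wedge koszul_diff_anti.
Qed.

Lemma vec_wedgeK v x : vec_wedge v (vec_wedge v x) = 0.
Proof.
by apply: (can_inj starK); rewrite linear0 !star_vec_wedge koszul_diffK.
Qed.

Lemma wedge1x x : wedge (ext1 R n) x = x.
Proof.
apply/ffunP => C; rewrite ffunE (bigD1 set0) ?sub0set //= big1 => [|A /andP[_]].
  by rewrite addr0 ffunE eqxx inversionsE big_set0 expr0 !mul1r setD0.
by rewrite ffunE => /negPf->; rewrite mul0r mulr0.
Qed.

(** The sign of [i] in [C] is the product of its signs in [A] and in [C :\: A].
    Together with [ext_ind] this reduces products to products with vectors. *)
Lemma vec_wedgeA v x y : wedge (vec_wedge v x) y = vec_wedge v (wedge x y).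
Proof.
apply/ffunP => C; rewrite ffunE vec_wedgeE.
under eq_bigr do rewrite vec_wedgeE mulr_suml mulr_sumr.
rewrite (exchange_big_dep (fun i => i \in C)) /=; last first.
  by move=> A i /subsetP; apply.
apply: eq_bigr => i iC; rewrite ffunE !mulr_sumr.
rewrite (reindex_onto (fun A => i |: A) (fun A => A :\ i)) /=; last first.
  by move=> A /andP[_ iA]; rewrite setD1K.
apply: eq_big => [A|A /andP[/andP[sAC _]]].
  rewrite setU11 andbT subsetD1 subUset sub1set iC /=; congr (_ && _).
  apply/eqP/idP => [<-|/setU1K//]; by rewrite !inE eqxx.
move=> /eqP A_E; have iA : i \notin A by rewrite -A_E !inE eqxx.
rewrite setU1K // -setDDl.
have /subsetP sA : A \subset C by apply: subset_trans sAC; exact: subsetUr.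
set D := C :\ i :\: A.
rewrite inversionsE (big_setU1 i) //= -inversionsE.
rewrite nb_belowU // ltnn add0n.
have -> : nb_below C i = (nb_below A i + nb_below D i)%N.
  rewrite (nb_belowD i iC) ltnn add0n !nb_belowE.
  rewrite [LHS](big_setID A) /=; congr (_ + _)%N; apply: eq_bigl => k.
  rewrite !inE; case: (boolP (k \in A)) => kA; rewrite ?andbF // !andbT.
  by rewrite sA // andbT; apply: contraNneq iA => <-.
rewrite !exprD; ring.
Qed.

Definition ext_delta A : ext R n := [ffun B => (B == A)%:R].

Lemma ext_deltaE x : x = \sum_A x A *: ext_delta A.
Proof.
apply/ffunP => B; rewrite sum_ffunE (bigD1 B) //= big1 => [|A AB].
  by rewrite !ffunE eqxx addr0 /GRing.scale /= mulr1.
by rewrite !ffunE eq_sym (negPf AB) scaler0.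
Qed.

(** Induction over iterated products of vectors, which span the algebra. *)
Lemma ext_ind (P : ext R n -> Prop) :
  (forall k x y, P x -> P y -> P (k *: x + y)) ->
  P (ext1 R n) -> (forall v x, P x -> P (vec_wedge v x)) -> forall x, P x.
Proof.
move=> Plin P1 Pv.
have P0 : P 0 by rewrite -[0](addNr (ext1 R n)) -scaleN1r; apply: Plin.
have PZ k x : P x -> P (k *: x) by move=> Px; rewrite -[_ *: _]addr0; apply: Plin.
have PD A : P (ext_delta A).
  elim: {A}#|A| {-2}A (leqnn #|A|) => [|m IH] A.
    rewrite leqn0 cards_eq0 => /eqP->.
    by have -> : ext_delta set0 = ext1 R n by apply/ffunP => B; rewrite !ffunE.
  have [-> _|[i iA] cA] := set_0Vmem A.
    by apply: IH; rewrite cards0.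
  have cAi : (#|A :\ i| <= m)%N by move: cA; rewrite (cardsD1 i) iA.
  have := PZ ((-1) ^+ nb_below A i) _ (Pv (fun k => (k == i)%:R) _ (IH _ cAi)).
  congr P; apply/ffunP => C; rewrite ffunE vec_wedgeE [RHS]ffunE.
  rewrite big_mkcond (bigD1 i) //= big1 => [|j ji]; last first.
    by rewrite (negPf ji) mul0r mulr0 if_same.
  rewrite addr0 eqxx mul1r ffunE; case: ifPn => iC.
    have -> : (C :\ i == A :\ i) = (C == A).
      by apply/eqP/eqP => [E|->//]; rewrite -(setD1K iC) E setD1K.
    case: eqP => [->|_]; last by rewrite !mulr0 scaler0.
    by rewrite mulr1 /GRing.scale /= -expr2 sqrr_sign.
  rewrite scaler0; case: eqP => // CA; by rewrite CA iA in iC.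
by move=> x; rewrite (ext_deltaE x); elim/big_rec: _ => // A y _ Py; exact: Plin.
Qed.

(** The sign in the Leibniz rule, without reference to homogeneous elements. *)
Definition invol x : ext R n := [ffun A : {set 'I_n} => (-1) ^+ #|A| * x A].

Lemma invol_linear : linear invol.
Proof.
move=> k x y; apply/ffunP => B; rewrite !ffunE /GRing.scale /=; ring.
Qed.
HB.instance Definition _ := GRing.isLinear.Build R _ _ _ invol invol_linear.

Lemma invol_vec_wedge v x : invol (vec_wedge v x) = - vec_wedge v (invol x).
Proof.
apply/ffunP => C; rewrite ffunE [RHS]ffunE !vec_wedgeE mulr_sumr -sumrN.
apply: eq_bigr => i iC; rewrite ffunE (cardsD1 i) iC exprD expr1; ring.
Qed.

Lemma koszul_diff1 v : koszul_diff v (ext1 R n) = 0.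
Proof.
apply/ffunP => B; rewrite koszul_diffE ffunE; apply: big1 => i _.
by rewrite ffunE setU_eq0 -cards_eq0 cards1 /= !mulr0.
Qed.

Lemma invol1 : invol (ext1 R n) = ext1 R n.
Proof.
apply/ffunP => B; rewrite !ffunE; case: eqP => [->|_]; last by rewrite mulr0.
by rewrite cards0 mul1r.
Qed.

Lemma wedgeDl x x' y : wedge (x + x') y = wedge x y + wedge x' y.
Proof. by rewrite -[x]scale1r wedge_linearl !scale1r. Qed.
Lemma wedgeDr x y y' : wedge x (y + y') = wedge x y + wedge x y'.
Proof. by rewrite -[y]scale1r wedge_linearr !scale1r. Qed.
Lemma wedge0x y : wedge 0 y = 0 :> ext R n.
Proof. by apply: (addrI (wedge 0 y)); rewrite -wedgeDl !addr0. Qed.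
Lemma wedgex0 x : wedge x 0 = 0 :> ext R n.
Proof. by apply: (addrI (wedge x 0)); rewrite -wedgeDr !addr0. Qed.
Lemma wedgeZl k x y : wedge (k *: x) y = k *: wedge x y.
Proof. by rewrite -[k *: x]addr0 wedge_linearl wedge0x addr0. Qed.
Lemma wedgeZr k x y : wedge x (k *: y) = k *: wedge x y.
Proof. by rewrite -[k *: y]addr0 wedge_linearr wedgex0 addr0. Qed.
Lemma wedgeNl x y : wedge (- x) y = - wedge x y.
Proof. by rewrite -scaleN1r wedgeZl scaleN1r. Qed.
Lemma koszul_diff_wedge v x y :
  koszul_diff v (wedge x y)
  = wedge (koszul_diff v x) y + wedge (invol x) (koszul_diff v y).
Proof.
elim/ext_ind: x => [k x x' IH IH'||u x IH].
- rewrite wedge_linearl !linearP /= IH IH' wedgeDl wedgeZl.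
  by rewrite (wedgeDl (k *: _)) wedgeZl scalerDr addrACA.
- by rewrite koszul_diff1 invol1 !wedge1x wedge0x add0r.
rewrite vec_wedgeA; have := koszul_diff_vec_wedge v u (wedge x y).
move/(canRL (addrK _)) => ->; rewrite IH.
have := koszul_diff_vec_wedge v u x; move/(canRL (addrK _)) => ->.
rewrite invol_vec_wedge wedgeDl !wedgeNl wedgeZl !vec_wedgeA linearD /=.
by rewrite opprD addrA.
Qed.

Lemma wedge_vec_wedge v x y :
  wedge x (vec_wedge v y) = vec_wedge v (wedge (invol x) y).
Proof.
elim/ext_ind: x => [k x x' IH IH'||u x IH].
- by rewrite wedge_linearl IH IH' !linearP /= wedge_linearl linearP.
- by rewrite invol1 !wedge1x.
rewrite vec_wedgeA IH invol_vec_wedge wedgeNl vec_wedgeA linearN /=.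
exact: vec_wedge_anti.
Qed.

Definition pair_ext x y : R := \sum_A x A * y A.

Lemma koszul_diff_adjoint v x y :
  pair_ext (koszul_diff v x) y = pair_ext x (vec_wedge v y).
Proof.
rewrite /pair_ext.
under eq_bigr do rewrite koszul_diffE mulr_suml.
under [RHS]eq_bigr do rewrite vec_wedgeE mulr_sumr.
rewrite !pair_big_dep /=.
rewrite (reindex_onto (fun p => (p.1 :\ p.2, p.2)) (fun p => (p.2 |: p.1, p.2))) /=.
  apply: eq_big => -[A i] /=.
    rewrite !inE eqxx /= xpair_eqE eqxx andbT.
    by apply/eqP/idP => [<-|/setD1K//]; rewrite setU11.
  move=> /andP[_]; rewrite xpair_eqE eqxx andbT => /eqP E.
  rewrite E; have iA : i \in A by rewrite -E setU11.
  rewrite (nb_belowD i iA) ltnn add0n; ring.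
by move=> [A i] /= iA; rewrite setU1K.
Qed.

End ExteriorAlgebra.

(** * Acyclicity of the Koszul complex of a regular sequence *)

Section KoszulAcyclic.
Variables (S : comNzRingType) (n : nat) (f : 'I_n -> S).
Implicit Types (x y z : ext S n) (A B C : {set 'I_n}).

(** The subcomplex of the first [k] basis vectors. *)
Definition below k x := forall A i, i \in A -> (k <= i)%N -> x A = 0.

(** Over the first [k + 1] vectors, an element is [x0 + e_k /\ x1] with [x0] and
    [x1] over the first [k]; contraction against [e_k] finds [x1]. *)
Lemma below_split (i0 : 'I_n) x : below i0.+1 x ->
  let e := fun i => (i == i0)%:R : S in
  let x1 := koszul_diff e x in
  below i0 x1 /\ below i0 (x - vec_wedge e x1).
Proof.
move=> bx e x1.
have x1E B : x1 B = if i0 \in B then 0 else (-1) ^+ nb_below B i0 * x (i0 |: B).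
  rewrite koszul_diffE big_mkcond (bigD1 i0) //= big1 => [|i ii0]; last first.
    by rewrite /e (negPf ii0) mul0r mulr0 if_same.
  by rewrite /e eqxx mul1r addr0; case: (i0 \in B).
have b1 : below i0 x1.
  move=> A i iA; rewrite leq_eqVlt => /orP[/eqP/val_inj E|lti].
    by rewrite x1E E iA.
  by rewrite x1E (bx _ i) ?mulr0 ?if_same // inE iA orbT.
split=> // A i iA lei; rewrite ffunE [X in _ + X]ffunE.
rewrite vec_wedgeE big_mkcond (bigD1 i0) //= big1 => [|j ji0]; last first.
  by rewrite /e (negPf ji0) mul0r mulr0 if_same.
rewrite /e eqxx mul1r addr0 x1E !inE eqxx /=.
case: ifPn => [i0A|i0A].
  by rewrite (nb_belowD i0 i0A) ltnn add0n setD1K // signrMK subrr.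
rewrite subr0 (bx _ i) // ltn_neqAle lei andbT.
by apply: contraNneq i0A => /val_inj ->.
Qed.

Lemma koszul_diff0 x : koszul_diff f x set0 = \sum_i x [set i] * f i.
Proof.
rewrite koszul_diffE; apply: eq_big => [i|i _]; first by rewrite inE.
by rewrite nb_belowE big_set0 mul1r setU0 mulrC.
Qed.

Lemma koszul_diff_vec (a : 'I_n -> S) :
  koszul_diff f (vec_wedge a (ext1 S n)) = (\sum_i a i * f i) *: ext1 S n.
Proof. by rewrite -koszul_diff_vec_wedge koszul_diff1 linear0 addr0. Qed.

Lemma belowD k x y : below k x -> below k y -> below k (x + y).
Proof. by move=> bx by_ A i iA ki; rewrite ffunE (bx _ i) // (by_ _ i) ?addr0. Qed.

Lemma belowZ k s x : below k x -> below k (s *: x).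
Proof. by move=> bx A i iA ki; rewrite ffunE (bx _ i) // scaler0. Qed.

Lemma belowW k x : below k x -> below k.+1 x.
Proof. by move=> bx A i iA ki; apply: (bx _ i iA); apply: ltnW. Qed.

Hypothesis hf : regular_sequence f.

(** Induction on the number of vectors. For a cycle [x0 + e_k /\ x1], the part
    [x1] is a cycle [s + d z] of the smaller complex. The degree [0] part of the
    cycle condition says that [f_k s] lies in the ideal of the previous [f_i];
    by regularity so does [s], so [s] is a boundary too. With [x1 = d Z], adding
    [d (e_k /\ Z)] to the cycle moves it into the smaller complex. *)
Lemma koszul_acyclic_below k x : (k <= n)%N -> below k x -> koszul_diff f x = 0 ->
  exists s y, below k y /\ x = s *: ext1 S n + koszul_diff f y.
Proof.
elim: k x => [|k IH] x kn bx dx.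
  exists (x set0), 0; split; first by move=> A i; rewrite ffunE.
  rewrite linear0 addr0; apply/ffunP => A; rewrite !ffunE.
  have [->|[i iA]] := set_0Vmem A; first by rewrite eqxx /GRing.scale /= mulr1.
  rewrite (bx A i) //; case: eqP => [A0|]; last by rewrite scaler0.
  by rewrite A0 inE in iA.
pose i0 := Ordinal kn; have := below_split (i0 := i0) bx => /=.
set e := fun i => _; set x1 := koszul_diff e x => -[b1 b0].
set x0 := x - _ in b0.
have dx1 : koszul_diff f x1 = 0 by rewrite koszul_diff_anti dx linear0 oppr0.
have dwe z : koszul_diff f (vec_wedge e z) =
    f i0 *: z - vec_wedge e (koszul_diff f z).
  have := koszul_diff_vec_wedge f e z; rewrite (bigD1 i0) //= big1 => [|i ii0].
    by rewrite /e eqxx mul1r addr0 => /(canRL (addrK _)).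
  by rewrite /e (negPf ii0) mul0r.
have [s [z [bz x1E]]] := IH x1 (ltnW kn) b1 dx1.
have dx0 : koszul_diff f x0 = - (f i0 *: x1).
  by rewrite linearB /= dx dwe dx1 linear0 subr0 sub0r.
have [a sE] : exists a : 'I_n -> S, s = \sum_(j < n | (j < i0)%N) a j * f j.
  apply: (proj2 hf i0 s); exists (fun j => - (x0 [set j] + f i0 * z [set j])).
  have E : \sum_i x0 [set i] * f i = - (f i0 * (s + \sum_i z [set i] * f i)).
    rewrite -!koszul_diff0 dx0 x1E !ffunE eqxx.
    by congr (- (_ * (_ + _))); rewrite /GRing.scale /= mulr1.
  transitivity (\sum_(j < n) - (x0 [set j] + f i0 * z [set j]) * f j).
    under eq_bigr do rewrite mulNr mulrDl -mulrA.
    by rewrite sumrN big_split /= -mulr_sumr E; ring.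
  rewrite [RHS]big_mkcond; apply: eq_bigr => j _; case: ltnP => [//|ij].
  by rewrite (b0 _ j) ?inE // (bz _ j) ?inE // mulr0 addr0 oppr0 mul0r.
pose a' (j : 'I_n) := if (j < i0)%N then a j else 0.
pose Z := z + vec_wedge a' (ext1 S n).
have bZ : below i0 Z.
  apply: belowD => // A i iA ki; rewrite vec_wedgeE; apply: big1 => j jA.
  rewrite /a'; case: ltnP => [ji|_]; last by rewrite mul0r mulr0.
  rewrite ffunE; case: eqP => [A0|_]; last by rewrite !mulr0.
  have : i \in A :\ j.
    by rewrite !inE iA andbT; apply: contraTneq ki => ->; rewrite -ltnNge.
  by rewrite A0 inE.
have dZ : koszul_diff f Z = x1.
  rewrite linearD /= koszul_diff_vec x1E addrC; congr (_ *: _ + _).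
  rewrite sE [RHS]big_mkcond; apply: eq_bigr => j _; rewrite /a'.
  by case: ifP; rewrite ?mul0r.
have [s' [y [by_ E]]] : exists s y, below k y /\
    x0 + f i0 *: Z = s *: ext1 S n + koszul_diff f y.
  apply: IH; [exact: ltnW|apply: belowD => //; exact: belowZ|].
  by rewrite linearD linearZ /= dx0 dZ addNr.
exists s', (y - vec_wedge e Z); split.
  apply: belowD; first exact: belowW.
  rewrite -scaleN1r; apply: belowZ => A i iA ki; rewrite vec_wedgeE; apply: big1 => j jA.
  rewrite /e; case: eqP => [->|_]; last by rewrite mul0r mulr0.
  rewrite (bZ _ i) ?mulr0 //; last exact: ltnW.
  by rewrite !inE iA andbT; apply: contraTneq ki => ->; rewrite -ltnNge.
rewrite linearB /= addrA -E dwe dZ /x0; linear_identity.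
Qed.

Lemma koszul_acyclic x : koszul_diff f x = 0 ->
  exists s y, x = s *: ext1 S n + koszul_diff f y.
Proof.
move=> dx; have [|s [y [_ ->]]] := koszul_acyclic_below (leqnn n) _ dx.
  by move=> A i _; rewrite leqNgt ltn_ord.
by exists s, y.
Qed.

Lemma vec_wedge_acyclic x : vec_wedge f x = 0 ->
  exists s y, x = s *: unstar (ext1 S n) + vec_wedge f y.
Proof.
move=> dx; have := star_vec_wedge f x; rewrite dx linear0 => /esym.
move=> /koszul_acyclic[s [y E]]; exists s, (unstar y).
by rewrite -[LHS]starK E linearD linearZ /= unstar_koszul_diff.
Qed.

Lemma vec_wedge_augment s y : s *: unstar (ext1 S n) = vec_wedge f y ->
  ideal_gen f s.
Proof.
move=> /(congr1 (@star S n)); rewrite linearZ /= unstarK star_vec_wedge.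
move=> /(congr1 (fun x : ext S n => x set0)).
rewrite koszul_diff0 !ffunE eqxx /GRing.scale /= mulr1 => ->.
by exists (fun i => star y [set i]).
Qed.

(** A relation is a Koszul cycle of degree [1], hence a boundary up to a constant
    in degree [0]. *)
Lemma regular_relation (b : 'I_n -> S) : \sum_i b i * f i = 0 ->
  forall i, ideal_gen f (b i).
Proof.
move=> bf i.
have /koszul_acyclic[s [y E]] : koszul_diff f (vec_wedge b (ext1 S n)) = 0.
  by rewrite koszul_diff_vec bf scale0r.
have := congr1 (fun x : ext S n => x [set i]) E.
rewrite vec_wedgeE big_set1 setDv [ext1 _ _ _]ffunE eqxx mulr1.
rewrite nb_belowE big_set1 ltnn mul1r => ->.
rewrite !ffunE -cards_eq0 cards1 /= scaler0 add0r.
exists (fun j => if j \notin [set i] then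
  (-1) ^+ #|[set k in [set i] | (k < j)%N]| * y (j |: [set i]) else 0).
rewrite big_mkcond; apply: eq_bigr => j _; case: ifP => _; last by rewrite mul0r.
by rewrite mulrAC -mulrA.
Qed.
End KoszulAcyclic.

(** * Adjoining one variable *)

Definition submodule (S : comNzRingType) (X : lmodType S) (P : X -> Prop) :=
  P 0 /\ forall k x y, P x -> P y -> P (k *: x + y).

Section Submodule.
Variables (S : comNzRingType) (X : lmodType S) (P : X -> Prop).
Hypothesis Psub : submodule P.

Lemma submodule0 : P 0. Proof. by case: Psub. Qed.
Lemma submoduleZ k x : P x -> P (k *: x).
Proof. by case: Psub => P0 PL Px; rewrite -[_ *: _]addr0; apply: PL. Qed.
Lemma submoduleD x y : P x -> P y -> P (x + y).
Proof. by case: Psub => P0 PL Px Py; rewrite -[x]scale1r; apply: PL. Qed.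
Lemma submoduleN x : P x -> P (- x).
Proof. by move=> Px; rewrite -scaleN1r; apply: submoduleZ. Qed.
Lemma submoduleB x y : P x -> P y -> P (x - y).
Proof. by move=> Px Py; apply: submoduleD => //; apply: submoduleN. Qed.
End Submodule.

Lemma linearE (S : comNzRingType) (X Y : lmodType S) (h : {linear X -> Y}) :
  ((forall x y, h (x + y)%R = (h x + h y)%R) * (forall x, h (- x)%R = (- h x)%R) *
   (forall k x, h (k *: x)%R = (k *: h x)%R) * (h 0%R = 0%R))%type.
Proof.
by do !split=> *; rewrite ?linearD ?linearN ?linear0 //; exact: linearZ_LR.
Qed.

(** [Z] stands for being zero modulo the [g_l] already used, and [P] for a
    finiteness condition (trivial for power series). Working with predicates
    instead of quotient modules keeps all elements over [S]. *)
Section HomotopyStep.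
Variables (S : comNzRingType) (X : lmodType S) (d al : {linear X -> X}).
Variables (P Z : X -> Prop) (g : S) (w : X).
Hypotheses (Psub : submodule P) (Zsub : submodule Z).
Hypotheses (Pd : forall x, P x -> P (d x)) (Pal : forall x, P x -> P (al x)).
Hypotheses (Zd : forall x, Z x -> Z (d x)) (Zal : forall x, Z x -> Z (al x)).
Hypothesis dd : forall x, Z (d (d x)).
Hypothesis aa : forall x, al (al x) = 0.
Hypothesis da : forall x, d (al x) + al (d x) = g *: x.
Hypotheses (Pw : P w) (dw : Z (d w)).
Hypothesis reg : forall x, Z (g *: x) -> Z x.
Hypothesis H1 : forall x, P x -> Z (d x) ->
  exists s y, P y /\ Z (x - s *: w - d y).

Definition zero_modg x := exists y, P y /\ Z (x - g *: y).

Let dL := linearE d.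
Let alL := linearE al.
Let P0 := submodule0 Psub.
Let PB := submoduleB Psub.
Let PD := submoduleD Psub.
Let PZ := submoduleZ Psub.
Let ZB := submoduleB Zsub.
Let ZD := submoduleD Zsub.
Let ZZ := submoduleZ Zsub.

Lemma zero_modg_sub : submodule zero_modg.
Proof.
split; first by exists 0; split=> //; rewrite scaler0 subr0; apply: submodule0.
move=> k x y [x' [Px' Zx]] [y' [Py' Zy]]; exists (k *: x' + y'); split.
  by apply: PD => //; apply: PZ.
have -> : k *: x + y - g *: (k *: x' + y') =
  k *: (x - g *: x') + (y - g *: y') by linear_identity.
by apply: ZD => //; apply: ZZ.
Qed.
Let Z1B := submoduleB zero_modg_sub.
Let Z1Z := submoduleZ zero_modg_sub.

Lemma zero_modgW x : Z x -> zero_modg x.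
Proof. by move=> Zx; exists 0; split=> //; rewrite scaler0 subr0. Qed.

Lemma zero_modgM y : P y -> zero_modg (g *: y).
Proof. by move=> Py; exists y; split=> //; rewrite subrr; apply: submodule0. Qed.

Lemma zero_modg_al x : zero_modg x -> zero_modg (al x).
Proof.
move=> [y [Py Zy]]; exists (al y); split; first exact: Pal.
by have := Zal Zy; rewrite linearB linearZ.
Qed.

Lemma d_al x : d (al x) = g *: x - al (d x).
Proof. by rewrite -da addrK. Qed.

(** The connecting homomorphism of multiplication by [g] sends [x] to [y] with
    [d x = g y]. Writing [y = s w + d y'], the difference [x - al y] is a cycle,
    and [al (d y') = g y' - d (al y')] is a boundary modulo [g]. *)
Lemma cycle_mod x : P x -> zero_modg (d x) ->
  exists s r z, P z /\ zero_modg (x - s *: al w - r *: w - d z).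
Proof.
move=> Px [y [Py Zy]].
have Zdy : Z (d y).
  apply: reg.
  have -> : g *: d y = d (d x) - d (d x - g *: y).
    by rewrite !dL; linear_identity.
  by apply: ZB => //; apply: Zd.
have [s [y' [Py' Zy']]] := H1 Py Zdy.
have [||r [z [Pz Zz]]] := H1 (x := x - al y); first by apply: PB => //; apply: Pal.
  have -> : d (x - al y) = (d x - g *: y) + al (d y).
    by rewrite !dL d_al; linear_identity.
  by apply: ZD => //; apply: Zal.
exists s, r, (z - al y'); split; first by apply: PB => //; apply: Pal.
exists y'; split=> //.
have -> : x - s *: al w - r *: w - d (z - al y') - g *: y' =
   (x - al y - r *: w - d z) + al (y - s *: w - d y').
  by rewrite !alL !dL d_al; linear_identity.
by apply: ZD => //; apply: Zal.
Qed.

(** If [al x] is a boundary modulo [g], then so is the term [r w] of [cycle_mod]: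
    [r al w = d u] modulo [g] lifts to [g r w = g d q] after applying [d], and
    [g] cancels. *)
Lemma chained_cycle_mod x x' : P x -> P x' ->
  zero_modg (d x) -> zero_modg (d x' + al x) ->
  exists s z, P z /\ zero_modg (x - s *: al w - d z).
Proof.
move=> Px Px' Zx [y2 [Py2 Zx']].
have [s [r [z [Pz [y' [Py' E]]]]]] := cycle_mod Px Zx.
pose q := y2 - z - al y'.
have Pq : P q by apply: PB; [exact: PB|exact: Pal].
have Zq : Z (r *: w - d q).
  apply: reg.
  have -> : g *: (r *: w - d q) =
    d ((d x' + al x - g *: y2) - al (x - s *: al w - r *: w - d z - g *: y'))
     - d (d (x' - al z)) + r *: al (d w).
    rewrite /q !(alL, aa, dL, d_al).
    linear_identity.
  apply: ZD; last by apply: ZZ; apply: Zal.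
  apply: ZB => //; apply: Zd; apply: ZB => //; exact: Zal.
exists s, (z + q); split; first exact: PD.
exists y'; split=> //.
have -> : x - s *: al w - d (z + q) - g *: y' =
  (x - s *: al w - r *: w - d z - g *: y') + (r *: w - d q).
  by rewrite !dL; linear_identity.
exact: ZD.
Qed.

(** The differential [d + t al] when [t] lowers divided powers. The top
    coefficient of a cycle is a cycle modulo [g], and its multiple of [al w] is
    the boundary of a multiple of [w] one power higher, so it can be removed;
    finiteness makes this stop. Only at power [0] is there no lower coefficient to
    feed to [chained_cycle_mod], and there the multiple of [w] stays. *)
Lemma divided_step (u : nat -> X) N :
  (forall i, P (u i)) -> (forall i, (N <= i)%N -> zero_modg (u i)) ->
  (forall i, zero_modg (d (u i) + al (u i.+1))) ->
  exists s v, [/\ forall i, P (v i), exists M, forall i, (M <= i)%N -> v i = 0 &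
    forall i, zero_modg (u i - (if i is 0 then s else 0) *: w - d (v i) - al (v i.+1))].
Proof.
elim: N u => [|N IH] u Pu Nu Du.
  exists 0, (fun=> 0); split=> //; first by exists 0%N.
  move=> i; have -> : (if i is 0 then 0 else 0) = 0 :> S by case: i.
  by congr zero_modg: (Nu i isT); rewrite dL alL; linear_identity.
have ZuN : zero_modg (d (u N)).
  rewrite -[d _](addrK (al (u N.+1))); apply: Z1B => //.
  by apply: zero_modg_al; apply: Nu.
have [r [s [z [Pz Zz rN]]]] : exists r s z,
   [/\ P z, zero_modg (u N - r *: w - s *: al w - d z) & N != 0 -> r = 0].
  case: N {IH} Nu ZuN => [|N] Nu ZuN.
    have [s [r [z [Pz Zz]]]] := cycle_mod (Pu 0%N) ZuN; exists r, s, z; split=> //.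
    by have -> : u 0%N - r *: w - s *: al w - d z = u 0%N - s *: al w - r *: w - d z
      by linear_identity.
  have [s [z [Pz Zz]]] := chained_cycle_mod (Pu N.+1) (Pu N) ZuN (Du N).
  by exists 0, s, z; split=> //; rewrite scale0r subr0.
pose v i := if i == N then z else if i == N.+1 then s *: w else 0.
pose u' i := u i - (if i is 0 then r else 0) *: w - d (v i) - al (v i.+1).
have Pv i : P (v i) by rewrite /v; case: ifP => // _; case: ifP => // _; exact: PZ.
have [||i|s' [v' [Pv' [M vM] Zv']]] := IH u'.
- by move=> i; do ![apply: PB => //]; [exact: PZ|exact: Pd|exact: Pal].
- move=> i; rewrite /u' /v leq_eqVlt => /orP[/eqP<-|Ni].
    rewrite eqxx (gtn_eqF (ltnSn N)) eqxx alL.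
    case: N rN {IH Nu ZuN v u' Pv} Zz => [_|N ->] // Zz; rewrite ?scale0r ?subr0 in Zz *.
      by have -> : u 0%N - r *: w - d z - s *: al w = u 0%N - r *: w - s *: al w - d z
        by linear_identity.
    have -> : u N.+1 - d z - s *: al w = u N.+1 - s *: al w - d z by linear_identity.
    exact: Zz.
  have -> : (if i is 0 then r else 0) = 0 by case: i Ni.
  rewrite scale0r subr0 (gtn_eqF Ni) (gtn_eqF (leqW Ni)).
  rewrite (gtn_eqF (Ni : (N.+1 < i.+1)%N)) alL subr0.
  case: ifP => [_|_]; rewrite dL ?subr0; last exact: Nu.
  by apply: Z1B; [exact: Nu|apply: Z1Z; apply: zero_modgW].
- have -> : d (u' i) + al (u' i.+1) = (d (u i) + al (u i.+1))
     - (if i is 0 then r else 0) *: d w - g *: v i.+1 - d (d (v i)).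
    rewrite /u' !(alL, aa, dL, d_al); linear_identity.
  apply: Z1B; last exact: zero_modgW.
  apply: Z1B; last exact: zero_modgM.
  by apply: Z1B => //; apply: Z1Z; apply: zero_modgW.
exists (r + s'), (fun i => v i + v' i); split.
- by move=> i; apply: PD.
- exists (M + N.+2)%N => i Mi; rewrite vM; last by apply: leq_trans Mi; apply: leq_addr.
  have Ni : (N.+1 < i)%N by apply: leq_trans Mi; apply: leq_addl.
  by rewrite /v !gtn_eqF ?addr0 //; apply: ltnW.
move=> i; have := Zv' i; congr zero_modg; rewrite /u' !(alL, dL).
by case: i => [|i]; linear_identity.
Qed.

(** The differential [d + t al] when [t] raises powers. Coefficients are treated
    from the lowest one upwards, each correction [z] changing the next
    coefficient [r] to be corrected; the multiple of [al w] in it is [d + t al] of a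
    multiple of [w] one power lower, except at power [0]. The process does not
    stop, but as a power series the sum of the corrections makes sense. *)
Lemma series_step (u : nat -> X) :
  (forall i, P (u i)) -> zero_modg (d (u 0%N)) ->
  (forall i, zero_modg (d (u i.+1) + al (u i))) ->
  exists s v, [/\ forall i, P (v i), zero_modg (u 0%N - s *: al w - d (v 0%N)) &
    forall i, zero_modg (u i.+1 - d (v i.+1) - al (v i))].
Proof.
move=> Pu Du0 Du.
(* Both corrections of a coefficient, chosen once and for all; the second one
   determines the next coefficient, whence the recursion for [r]. *)
have [x|h hP] := @choice X (S * X)%type (fun x p => P x -> zero_modg (d x) ->
    (exists x', P x' /\ zero_modg (d x' + al x)) ->
    P p.2 /\ zero_modg (x - p.1 *: al w - d p.2)).
  have [[Px [Zx [x' [Px' Zx']]]]|N] :=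
    pselect (P x /\ (zero_modg (d x) /\ exists x', P x' /\ zero_modg (d x' + al x))).
    by have [s [z Pz]] := chained_cycle_mod Px Px' Zx Zx'; exists (s, z).
  by exists (0, 0) => Px Zx Ex; case: N.
pose r := fix r i := if i is j.+1 then u i - al (h (r j)).2 else u 0%N.
have rP i : [/\ P (r i), P (h (r i)).2 &
    zero_modg (r i - (h (r i)).1 *: al w - d (h (r i)).2)].
  suff [Pr Zr] : P (r i) /\ zero_modg (d (r i)).
    have [|Ph Zh] := hP _ Pr Zr; last by split.
    exists (u i.+1); split=> //.
    case: i {Pr Zr} => [|i] /=; first exact: Du.
    by rewrite linearB /= aa subr0.
  elim: i => [|i [Pr Zr]] /=; first by split.
  have [|Ph Zh] := hP _ Pr Zr.
    exists (u i.+1); split=> //.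
    case: i {Pr Zr} => [|i] /=; first exact: Du.
    by rewrite linearB /= aa subr0.
  split; first by apply: PB => //; apply: Pal.
  have E : al (u i) = al (r i) by case: (i) => //= j; rewrite linearB /= aa subr0.
  have -> : d (u i.+1 - al (h (r i)).2) = (d (u i.+1) + al (u i))
    - al (r i - (h (r i)).1 *: al w - d (h (r i)).2) - g *: (h (r i)).2.
    by rewrite E !(alL, aa, dL, d_al); linear_identity.
  apply: Z1B; last exact: zero_modgM.
  by apply: Z1B => //; apply: zero_modg_al.
exists (h (r 0%N)).1, (fun i => (h (r i)).2 + (h (r i.+1)).1 *: w); split.
- by move=> i; have [_ Ph _] := rP i; apply: PD => //; apply: PZ.
- have [_ _ Z0] := rP 0%N.
  have -> : u 0%N - (h (r 0%N)).1 *: al w - d ((h (r 0%N)).2 + (h (r 1%N)).1 *: w)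
    = (r 0%N - (h (r 0%N)).1 *: al w - d (h (r 0%N)).2) - (h (r 1%N)).1 *: d w.
    by rewrite !dL /=; linear_identity.
  by apply: Z1B => //; apply: Z1Z; apply: zero_modgW.
move=> i; have [_ _ Zi] := rP i.+1.
have -> : u i.+1 - d ((h (r i.+1)).2 + (h (r i.+2)).1 *: w)
    - al ((h (r i)).2 + (h (r i.+1)).1 *: w)
  = (r i.+1 - (h (r i.+1)).1 *: al w - d (h (r i.+1)).2)
    - (h (r i.+2)).1 *: d w.
  rewrite !(dL, alL); have -> : r i.+1 = u i.+1 - al (h (r i)).2 by [].
  by linear_identity.
by apply: Z1B => //; apply: Z1Z; apply: zero_modgW.
Qed.

(** Applying [d] to [s al w = d v + g y] gives [g s w = g d y]. *)
Lemma series_augment (J : S -> Prop) :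
  (forall s v, P v -> Z (s *: w - d v) -> J s) ->
  forall s v, P v -> zero_modg (s *: al w - d v) -> J s.
Proof.
move=> H2 s v Pv [y [Py Zy]]; apply: (H2 s y) => //; apply: reg.
have -> : g *: (s *: w - d y) =
  d (s *: al w - d v - g *: y) + s *: al (d w) + d (d v).
  by rewrite !dL d_al; linear_identity.
apply: ZD => //; apply: ZD; first exact: Zd.
by apply: ZZ; apply: Zal.
Qed.
End HomotopyStep.

(** * Adjoining several variables *)

Notation mexp k := {ffun 'I_k -> nat}.

Definition exp_pred k (e : mexp k) (l : 'I_k) : mexp k :=
  [ffun l' => (e l' - (l' == l))%N].

Definition exp0 k : mexp k := [ffun=> 0%N].

(** The exponent at which the coefficient multiplied by [t_l] is found: [t_l]
    lowers divided powers, and raises powers in a series. *)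
Definition exp_shift k (up : bool) (l : 'I_k) (e : mexp k) : option (mexp k) :=
  if up then Some (exp_succ e l) else
  if e l == 0%N then None else Some (exp_pred e l).

Definition shift k (V : nmodType) (up : bool) (l : 'I_k) (u : mexp k -> V)
    (e : mexp k) : V :=
  if exp_shift up l e is Some e' then u e' else 0.

(** [snoc] and [init] identify functions of [k + 1] exponents with sequences of
    functions of [k] exponents. *)
Definition snoc k (e : mexp k) (i : nat) : mexp k.+1 :=
  [ffun l : 'I_k.+1 => if insub (l : nat) is Some l' then e l' else i].
Definition init k (e : mexp k.+1) : mexp k :=
  [ffun l => e (widen_ord (leqnSn k) l)].

Section Exponents.
Variable k : nat.
Implicit Types (e : mexp k) (i : nat).

Lemma snoc_widen e i l : snoc e i (widen_ord (leqnSn k) l) = e l.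
Proof. by rewrite ffunE /= valK. Qed.

Lemma snoc_max e i : snoc e i ord_max = i.
Proof. by rewrite ffunE /= insubN // ltnn. Qed.

Lemma ord_caseS (l : 'I_k.+1) : (exists l', l = widen_ord (leqnSn k) l') \/ l = ord_max.
Proof.
have [lk|kl] := ltnP l k; first by left; exists (Ordinal lk); apply: val_inj.
by right; apply: val_inj; apply/eqP; rewrite eqn_leq kl -ltnS ltn_ord.
Qed.

Lemma snoc_init (e : mexp k.+1) : snoc (init e) (e ord_max) = e.
Proof.
apply/ffunP => l; case: (ord_caseS l) => [[l' ->]|->]; last exact: snoc_max.
by rewrite snoc_widen ffunE.
Qed.

Lemma init_snoc e i : init (snoc e i) = e.
Proof. by apply/ffunP => l; rewrite ffunE snoc_widen. Qed.

Lemma sum_snoc e i : (\sum_l snoc e i l = \sum_l e l + i)%N.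
Proof.
rewrite big_ord_recr /= snoc_max; congr (_ + _)%N.
by apply: eq_bigr => l _; rewrite snoc_widen.
Qed.

Lemma snoc_inj e e' i i' : snoc e i = snoc e' i' -> e = e' /\ i = i'.
Proof.
move=> E; split; first by rewrite -[LHS](init_snoc e i) E init_snoc.
by rewrite -(snoc_max e i) E snoc_max.
Qed.

Lemma snoc0 : snoc (exp0 k) 0 = exp0 k.+1.
Proof.
apply/ffunP => l; case: (ord_caseS l) => [[l' ->]|->].
  by rewrite snoc_widen !ffunE.
by rewrite snoc_max ffunE.
Qed.

Lemma succ_snoc e i l :
  exp_succ (snoc e i) (widen_ord (leqnSn k) l) = snoc (exp_succ e l) i.
Proof.
apply/ffunP => l'; rewrite ffunE; case: (ord_caseS l') => [[m ->]|->].
  by rewrite !snoc_widen ffunE -!val_eqE.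
by rewrite !snoc_max -val_eqE /= (gtn_eqF (ltn_ord l)) addn0.
Qed.

Lemma pred_snoc e i l :
  exp_pred (snoc e i) (widen_ord (leqnSn k) l) = snoc (exp_pred e l) i.
Proof.
apply/ffunP => l'; rewrite ffunE; case: (ord_caseS l') => [[m ->]|->].
  by rewrite !snoc_widen ffunE -!val_eqE.
by rewrite !snoc_max -val_eqE /= (gtn_eqF (ltn_ord l)) subn0.
Qed.

Lemma succ_snoc_max e i : exp_succ (snoc e i) ord_max = snoc e i.+1.
Proof.
apply/ffunP => l'; rewrite ffunE; case: (ord_caseS l') => [[m ->]|->].
  by rewrite !snoc_widen -val_eqE /= (ltn_eqF (ltn_ord m)) addn0.
by rewrite !snoc_max eqxx addn1.
Qed.

Lemma pred_snoc_max e i : exp_pred (snoc e i.+1) ord_max = snoc e i.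
Proof.
apply/ffunP => l'; rewrite ffunE; case: (ord_caseS l') => [[m ->]|->].
  by rewrite !snoc_widen -val_eqE /= (ltn_eqF (ltn_ord m)) subn0.
by rewrite !snoc_max eqxx subn1.
Qed.

Lemma sum_succ e l : (\sum_l' exp_succ e l l' = (\sum_l' e l').+1)%N.
Proof.
under eq_bigr do rewrite ffunE.
rewrite big_split /= -addn1; congr (_ + _)%N.
by rewrite (bigD1 l) //= eqxx big1 // => i /negPf->.
Qed.

Lemma succK e l : exp_pred (exp_succ e l) l = e.
Proof. by apply/ffunP => l'; rewrite !ffunE addnK. Qed.

Lemma predK e l : e l != 0%N -> exp_succ (exp_pred e l) l = e.
Proof.
move=> el; apply/ffunP => l'; rewrite !ffunE; case: eqP => [->|_].
  by rewrite subnK // lt0n.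
by rewrite subn0 addn0.
Qed.

Variable V : nmodType.
Implicit Type u : mexp k -> V.

Lemma shift_comm up l l' u e :
  shift up l (shift up l' u) e = shift up l' (shift up l u) e.
Proof.
case: (eqVneq l l') => [->//|ll'].
rewrite /shift /exp_shift; case: up.
  by congr u; apply/ffunP => m; rewrite !ffunE addnAC.
have E m m' : m != m' -> exp_pred e m m' = e m'.
  by move=> mm; rewrite ffunE eq_sym (negPf mm) subn0.
case: (eqVneq (e l) 0%N) => el; case: (eqVneq (e l') 0%N) => el' //=;
  rewrite ?E ?(eq_sym l') ?el ?el' ?eqxx //.
by rewrite (negPf el) (negPf el'); congr u; apply/ffunP => m; rewrite !ffunE subnAC.
Qed.

End Exponents.

(** The homotopies and the [g_l] are indexed by all natural numbers, so that the
    induction on the number [k] of variables can use the first [k] of them. *)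
Section ManyVariables.
Variables (S : comNzRingType) (V : lmodType S) (c : nat).
Variables (d : {linear V -> V}) (al : nat -> {linear V -> V}) (g : nat -> S).
Variable w0 : V.
Hypothesis dd : forall x, d (d x) = 0.
Hypothesis aa : forall l x, al l (al l x) = 0.
Hypothesis anti : forall l l' x, al l (al l' x) = - al l' (al l x).
Hypothesis da : forall l x, d (al l x) + al l (d x) = g l *: x.
Hypothesis dw0 : d w0 = 0.
Hypothesis base : forall x, d x = 0 -> exists s y, x = s *: w0 + d y.

(** The submodule [(g_0, ..., g_(k-1)) V]. *)
Definition in_prefix k (x : V) := exists y : nat -> V, x = \sum_(l < k) g l *: y l.

Hypothesis reg : forall k x, (k < c)%N -> in_prefix k (g k *: x) -> in_prefix k x.

Lemma in_prefix_sub k : submodule (in_prefix k).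
Proof.
split; first by exists (fun=> 0); rewrite big1 // => l _; rewrite scaler0.
move=> s x y [x' ->] [y' ->]; exists (fun l => s *: x' l + y' l).
rewrite scaler_sumr -big_split; apply: eq_bigr => l _ /=; linear_identity.
Qed.

Lemma in_prefix_map k (h : {linear V -> V}) x : in_prefix k x -> in_prefix k (h x).
Proof.
move=> [y ->]; exists (fun l => h (y l)); rewrite linear_sum.
by apply: eq_bigr => l _; rewrite linearZ_LR.
Qed.

Lemma in_prefixS k x : in_prefix k.+1 x <-> exists y, in_prefix k (x - g k *: y).
Proof.
split=> [[y ->]|[y [z E]]].
  by exists (y k), y; rewrite big_ord_recr /= addrK.
exists (fun l => if (l < k)%N then z l else y).
rewrite big_ord_recr /= ltnn -[x](subrK (g k *: y)) E; congr (_ + _).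
by apply: eq_bigr => l _; rewrite ltn_ord.
Qed.

Variable up : bool.

(** [d + sum_l t_l al_l]. *)
Definition total_diff k (u : mexp k -> V) (e : mexp k) : V :=
  d (u e) + \sum_(l < k) al l (shift up l u e).

Lemma shiftL k (l : 'I_k) s (u v : mexp k -> V) e :
  shift up l (s *: u + v) e = s *: shift up l u e + shift up l v e.
Proof. by rewrite /shift; case: exp_shift => [e'|] //; rewrite scaler0 addr0. Qed.

Lemma total_diff_linear k : linear (@total_diff k).
Proof.
move=> s u v; apply/funext => e; rewrite /total_diff.
under eq_bigr do rewrite shiftL linearP.
rewrite big_split /= -scaler_sumr.
have -> : (s *: u + v) e = s *: u e + v e by [].
rewrite linearP /=.
have -> : (s *: total_diff u + total_diff v) e =
  s *: total_diff u e + total_diff v e by [].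
rewrite /total_diff; linear_identity.
Qed.
HB.instance Definition _ k :=
  GRing.isLinear.Build S _ _ _ (@total_diff k) (@total_diff_linear k).

Definition lift_al k j (u : mexp k -> V) (e : mexp k) : V := al j (u e).
Lemma lift_al_linear k j : linear (@lift_al k j).
Proof. by move=> s u v; apply/funext => e; rewrite /lift_al linearP. Qed.
HB.instance Definition _ k j :=
  GRing.isLinear.Build S _ _ _ (@lift_al k j) (@lift_al_linear k j).

(** The squares and mixed terms of the anticommuting [al_l] cancel, as the [t_l]
    commute. *)
Lemma total_diffK k u e :
  total_diff (@total_diff k u) e = \sum_(l < k) g l *: shift up l u e.
Proof.
rewrite /total_diff linearD dd add0r linear_sum.
have E l : shift up l (total_diff u) e =
  d (shift up l u e) + \sum_(l' < k) al l' (shift up l (shift up l' u) e).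
  rewrite /shift; case: exp_shift => [e'|] //.
  by rewrite linear0 big1 ?addr0 // => l' _; rewrite linear0.
under [X in _ + X]eq_bigr do rewrite E linearD linear_sum /=.
rewrite big_split /= addrA -big_split /=.
under eq_bigr do rewrite da.
rewrite (@sum_antisym0 _ _ (fun l l' : 'I_k =>
  al l (al l' (shift up l (shift up l' u) e)))).
- by rewrite addr0.
- by move=> l; rewrite aa.
by move=> l l'; rewrite anti shift_comm.
Qed.

(** Divided powers have finite support, power series do not. *)
Definition admissible k (u : mexp k -> V) : Prop :=
  up -> exists N, forall e : mexp k, (N <= \sum_l e l)%N -> u e = 0.

Lemma admissible_sub k : submodule (@admissible k).
Proof.
split; first by exists 0%N.
move=> s u v au av Hup; have [N uN] := au Hup; have [M vM] := av Hup.
exists (N + M)%N => e NM; have -> : (s *: u + v) e = s *: u e + v e by [].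
rewrite uN ?vM ?scaler0 ?addr0 //; apply: leq_trans NM.
  exact: leq_addl.
exact: leq_addr.
Qed.

Lemma admissible_total_diff k u : admissible u -> admissible (@total_diff k u).
Proof.
move=> au Hup; have [N uN] := au Hup; exists N => e Ne.
rewrite /total_diff uN // linear0 big1 ?addr0 // => l _.
by rewrite /shift /exp_shift Hup uN ?linear0 // sum_succ; apply: leqW.
Qed.

Lemma admissible_lift k j u : admissible u -> admissible (@lift_al k j u).
Proof.
move=> au Hup; have [N uN] := au Hup; exists N => e Ne.
by rewrite /lift_al uN // linear0.
Qed.

(** The generator of the homology: adjoining a power series variable applies the
    homotopy to it, adjoining a divided power variable leaves it as it is. *)
Fixpoint gen_coef k : V :=
  if k is k'.+1 then (if up then gen_coef k' else al k' (gen_coef k')) else w0.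

Definition generator k (e : mexp k) : V := if e == exp0 k then gen_coef k else 0.

Lemma al_gen_coef k l : ~~ up -> (l < k)%N -> al l (gen_coef k) = 0.
Proof.
move=> /negPf nup; elim: k => //= k IH; rewrite nup ltnS leq_eqVlt.
by case/orP=> [/eqP->|lk]; [exact: aa|rewrite anti IH // linear0 oppr0].
Qed.

Lemma d_gen_coef k : in_prefix k (d (gen_coef k)).
Proof.
elim: k => [|k IH] /=; first by rewrite dw0; apply: submodule0; apply: in_prefix_sub.
case: ifP => _; apply/in_prefixS; first by exists 0; rewrite scaler0 subr0.
exists (gen_coef k).
have -> : d (al k (gen_coef k)) - g k *: gen_coef k = - al k (d (gen_coef k)).
  by rewrite -da; linear_identity.
by apply: submoduleN; [exact: in_prefix_sub|exact: in_prefix_map].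
Qed.

Lemma total_diff_generator k e : in_prefix k (total_diff (@generator k) e).
Proof.
have G := in_prefix_sub k; apply: submoduleD => //.
  rewrite /generator; case: ifP => _; first exact: d_gen_coef.
  by rewrite linear0; apply: submodule0.
rewrite big1; first exact: submodule0.
move=> l _; rewrite /shift /exp_shift /generator; case: ifPn => [_|nup].
  case: eqP => [/ffunP/(_ l)|_]; last by rewrite linear0.
  by rewrite !ffunE eqxx addn1.
case: ifP => _; first by rewrite linear0.
case: ifP => _; last by rewrite linear0.
exact: al_gen_coef.
Qed.

Lemma admissible_generator k : admissible (@generator k).
Proof.
move=> _; exists 1%N => e e0; rewrite /generator; case: eqP => // E.
by rewrite E big1 // in e0 => l _; rewrite ffunE.
Qed.

Definition zero_mod k (u : mexp k -> V) := forall e, in_prefix k (u e).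

Lemma zero_mod_sub k : submodule (@zero_mod k).
Proof.
split=> [e|s u v Zu Zv e]; first exact: (submodule0 (in_prefix_sub k)).
by case: (in_prefix_sub k) => _; apply.
Qed.

Definition cycles_lift k := forall u, admissible u -> zero_mod (@total_diff k u) ->
  exists s v, admissible v /\ zero_mod (u - s *: @generator k - total_diff v).

(** Divisibility by [g_k] is chosen coefficientwise; dividing [0] by [0] keeps the
    support finite. *)
Lemma zero_mod_step k (u : mexp k -> V) :
  admissible u -> (forall e, in_prefix k.+1 (u e)) ->
  zero_modg (@admissible k) (@zero_mod k) (g k) u.
Proof.
move=> au Zu.
have [e|y yP] := @choice (mexp k) V
    (fun e y => in_prefix k (u e - g k *: y) /\ (u e = 0 -> y = 0)).
  have [ue|ue] := pselect (u e = 0).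
    exists 0; split=> //; rewrite ue scaler0 subr0.
    exact: (submodule0 (in_prefix_sub k)).
  by have /in_prefixS[y Hy] := Zu e; exists y.
exists y; split; last by move=> e; case: (yP e).
move=> /au[N uN]; exists N => e Ne; case: (yP e) => _; apply; exact: uN.
Qed.

Lemma zero_mod_stepE k (u : mexp k -> V) :
  zero_modg (@admissible k) (@zero_mod k) (g k) u -> forall e, in_prefix k.+1 (u e).
Proof. by move=> [y [_ Zy]] e; apply/in_prefixS; exists (y e); apply: Zy. Qed.

Definition slice k (u : mexp k.+1 -> V) (i : nat) : mexp k -> V :=
  fun e => u (snoc e i).
Definition unslice k (v : nat -> mexp k -> V) : mexp k.+1 -> V :=
  fun e => v (e ord_max) (init e).

Lemma unsliceK k (v : nat -> mexp k -> V) i : slice (unslice v) i = v i.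
Proof. by apply/funext => e; rewrite /slice /unslice snoc_max init_snoc. Qed.

Lemma slice_total_diff k (u : mexp k.+1 -> V) i :
  slice (total_diff u) i = total_diff (slice u i) + lift_al k
    (if up then slice u i.+1 else if i is j.+1 then slice u j else 0).
Proof.
apply/funext => e; rewrite /slice /total_diff big_ord_recr /= addrA; congr (_ + _ + _).
  apply: eq_bigr => l _; congr (al _ _); rewrite /shift /exp_shift.
  by case: up; rewrite ?succ_snoc // snoc_widen pred_snoc; case: ifP.
rewrite /lift_al /shift /exp_shift; congr (al _ _); case: up.
  by rewrite succ_snoc_max.
by rewrite snoc_max; case: i => [|i] //=; rewrite pred_snoc_max.
Qed.

Lemma admissible_slice k (u : mexp k.+1 -> V) i : admissible u -> admissible (slice u i).
Proof.
move=> au /au[N uN]; exists N => e Ne; apply: uN.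
by rewrite sum_snoc; apply: leq_trans (leq_addr _ _).
Qed.

Lemma admissible_unslice k (v : nat -> mexp k -> V) : (forall i, admissible (v i)) ->
  (up -> exists M, forall i, (M <= i)%N -> v i = 0) -> admissible (unslice v).
Proof.
move=> av vfin Hup; have [M vM] := vfin Hup.
have [i|N NP] := @choice nat nat (fun i N =>
   forall e : mexp k, (N <= \sum_l e l)%N -> v i e = 0); first exact: av.
exists (M + \sum_(i < M) N i)%N => e.
rewrite -{1}(snoc_init e) sum_snoc /unslice => le_e.
have [Mi|iM] := leqP M (e ord_max); first by rewrite vM.
apply: NP; move: le_e; rewrite (bigD1 (Ordinal iM)) //=; move: iM; lia.
Qed.

Lemma cycles_lift0 : cycles_lift 0.
Proof.
move=> u au Zu; have E (e : mexp 0) : e = exp0 0 by apply/ffunP => -[].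
have G0 x : in_prefix 0 x <-> x = 0.
  by split=> [[y ->]|->]; [rewrite big_ord0|apply: submodule0; apply: in_prefix_sub].
have /G0 := Zu (exp0 0); rewrite /total_diff big_ord0 addr0 => /base[s [y uE]].
exists s, (fun=> y); split.
  by move=> _; exists 1%N => e; rewrite big_ord0.
move=> e; apply/G0; rewrite (E e).
have -> : (u - s *: @generator 0 - total_diff (fun=> y)) (exp0 0) =
  u (exp0 0) - s *: @generator 0 (exp0 0) - total_diff (fun=> y) (exp0 0) by [].
by rewrite uE /generator eqxx /total_diff big_ord0 /=; linear_identity.
Qed.


Lemma generator_snoc k (e : mexp k) i : generator (snoc e i) =
  if i is 0 then (if up then generator e else lift_al k (@generator k) e) else 0.
Proof.
rewrite /generator /lift_al /= -snoc0; case: i => [|i]; last first.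
  by case: eqP => // /snoc_inj[].
have -> : (snoc e 0 == snoc (exp0 k) 0) = (e == exp0 k).
  by apply/eqP/eqP => [/snoc_inj[]|->].
by case: up; case: ifP => // _; rewrite linear0.
Qed.

Section Step.
Variable k : nat.
Hypotheses (kc : (k < c)%N) (IH : cycles_lift k).

Let Zd (u : mexp k -> V) : zero_mod u -> zero_mod (total_diff u).
Proof.
move=> Zu e; apply: (submoduleD (in_prefix_sub k)); first exact: in_prefix_map.
elim/big_rec: _ => [|l x _ Gx]; first exact: (submodule0 (in_prefix_sub k)).
apply: (submoduleD (in_prefix_sub k)) => //; apply: in_prefix_map; rewrite /shift.
by case: exp_shift => [e'|]; [exact: Zu|exact: (submodule0 (in_prefix_sub k))].
Qed.

Let Zal (u : mexp k -> V) : zero_mod u -> zero_mod (lift_al k u).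
Proof. by move=> Zu e; apply: in_prefix_map. Qed.

Let Zdd (u : mexp k -> V) : zero_mod (total_diff (total_diff u)).
Proof.
move=> e; rewrite total_diffK.
exists (fun l => if insub l is Some l' then shift up l' u e else 0).
by apply: eq_bigr => l _; rewrite valK.
Qed.

Let alal (u : mexp k -> V) : lift_al k (lift_al k u) = 0.
Proof. by apply/funext => e; apply: aa. Qed.

Let dal (u : mexp k -> V) :
  total_diff (lift_al k u) + lift_al k (total_diff u) = g k *: u.
Proof.
apply/funext => e.
transitivity (total_diff (lift_al k u) e + lift_al k (total_diff u) e) => //.
rewrite /total_diff /lift_al linearD linear_sum addrACA da -[RHS]addr0; congr (_ + _).
rewrite -big_split /= big1 // => l _; rewrite /shift.
by case: exp_shift => [e'|]; rewrite ?linear0 ?addr0 // anti addNr.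
Qed.

Let regZ (u : mexp k -> V) : zero_mod (g k *: u) -> zero_mod u.
Proof. by move=> Zu e; apply: reg => //; apply: Zu. Qed.

Lemma cycles_liftS : cycles_lift k.+1.
Proof.
move=> u au Zu.
have ZS i : zero_modg (@admissible k) (@zero_mod k) (g k)
    (total_diff (slice u i) + lift_al k
      (if up then slice u i.+1 else if i is j.+1 then slice u j else 0)).
  rewrite -slice_total_diff; apply: zero_mod_step.
    exact/admissible_slice/admissible_total_diff.
  by move=> e; apply: Zu.
have sub := zero_modg_sub (g k) (@admissible_sub k) (@zero_mod_sub k).
suff [s [v [av fv Zv]]] : exists s v, [/\ forall i, admissible (v i),
   up -> exists M, forall i, (M <= i)%N -> v i = 0 & forall i,
   zero_modg (@admissible k) (@zero_mod k) (g k)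
     (slice u i - s *: slice (@generator k.+1) i - (total_diff (v i) + lift_al k
    (if up then v i.+1 else if i is j.+1 then v j else 0)))].
  exists s, (unslice v); split; first exact: admissible_unslice.
  move=> e; rewrite -(snoc_init e); have := zero_mod_stepE (Zv (e ord_max)) (init e).
  congr in_prefix; have := slice_total_diff (unslice v) (e ord_max); rewrite !unsliceK.
  have -> : (if up then v (e ord_max).+1 else
      match e ord_max with 0%N => 0 | j.+1 => slice (unslice v) j end) =
      (if up then v (e ord_max).+1 else if e ord_max is j.+1 then v j else 0).
    by case: (e ord_max) => // j; rewrite unsliceK.
  by move=> <-.
have slice_generator i : slice (@generator k.+1) i =
    if i is 0 then (if up then @generator k else lift_al k (@generator k)) else 0.
  by apply/funext => e; rewrite /slice generator_snoc; case: i; case: up.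
have au_i i : admissible (slice u i) by apply: admissible_slice.
have [Hup|/negPf Hup] := boolP up; rewrite Hup in slice_generator ZS *.
  have [N uN] := au Hup.
  have [|s [v [av fv Zv]]] := @divided_step _ _ (@total_diff k) (@lift_al k k)
    (@admissible k) (@zero_mod k) (g k) (@generator k) (@admissible_sub k)
    (@zero_mod_sub k) (@admissible_total_diff k) (@admissible_lift k k) Zd Zal
    Zdd alal dal (@admissible_generator k) (@total_diff_generator k) regZ
    IH (slice u) N au_i _ ZS.
    move=> i Ni; have -> : slice u i = 0; last exact: (submodule0 sub).
    apply/funext => e; rewrite /slice uN // sum_snoc.
    exact: leq_trans Ni (leq_addl _ _).
  exists s, v; split=> // i; have := Zv i; congr zero_modg; rewrite slice_generator.
  by case: i => [|i]; linear_identity.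
have [||s [v [av Z0 Zv]]] := @series_step _ _ (@total_diff k) (@lift_al k k)
    (@admissible k) (@zero_mod k) (g k) (@generator k) (@admissible_sub k)
    (@zero_mod_sub k) (@admissible_lift k k) Zd Zal Zdd alal dal
    (@admissible_generator k) (@total_diff_generator k) regZ IH (slice u) au_i.
- by have := ZS 0%N; rewrite linear0 addr0.
- by move=> i; apply: ZS.
exists s, v; split=> // i; rewrite slice_generator; case: i => [|i].
  by have := Z0; congr zero_modg; rewrite linear0; linear_identity.
by have := Zv i; congr zero_modg; linear_identity.
Qed.

Variable J : S -> Prop.
Definition augmented k' := forall s v, admissible v ->
  zero_mod (s *: @generator k' - total_diff v) -> J s.

Lemma augmentedS : up = false -> augmented k -> augmented k.+1.
Proof.
move=> Hup H2 s v av Zv.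
apply: (@series_augment _ _ (@total_diff k) (@lift_al k k) (@admissible k)
  (@zero_mod k) (g k) (@generator k) (@zero_mod_sub k) Zd Zal Zdd dal
  (@total_diff_generator k) regZ _ H2 s (slice v 0)).
  exact: admissible_slice.
have -> : s *: lift_al k (@generator k) - total_diff (slice v 0) =
    slice (s *: @generator k.+1 - total_diff v) 0.
  have := slice_total_diff v 0; rewrite Hup linear0 addr0 => <-.
  apply/funext => e.
  transitivity (s *: lift_al k (@generator k) e - total_diff v (snoc e 0)) => //.
  transitivity (s *: @generator k.+1 (snoc e 0) - total_diff v (snoc e 0)) => //.
  by rewrite generator_snoc Hup.
apply: zero_mod_step; last by move=> e; apply: Zv.
by move=> H; rewrite Hup in H.
Qed.

End Step.

Lemma cycles_lift_all k : (k <= c)%N -> cycles_lift k.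
Proof.
elim: k => [_|k IH kc]; first exact: cycles_lift0.
by apply: cycles_liftS => //; apply: IH; apply: ltnW.
Qed.

Lemma augmented_all (J : S -> Prop) k : up = false -> (k <= c)%N ->
  (forall s y, s *: w0 = d y -> J s) -> augmented J k.
Proof.
move=> Hup kc J0; elim: k kc => [_|k IH kc].
  move=> s v _ Zv; apply: (J0 s (v (exp0 0))).
  have [y] := Zv (exp0 0); rewrite big_ord0.
  have -> : (s *: @generator 0 - total_diff v) (exp0 0) =
    s *: @generator 0 (exp0 0) - total_diff v (exp0 0) by [].
  by rewrite /generator eqxx /total_diff big_ord0 addr0 => /eqP; rewrite subr_eq0 => /eqP.
by apply: augmentedS => //; apply: IH; apply: ltnW.
Qed.

End ManyVariables.

(** * The resolution and its dual in coordinates *)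

Section Bases.
Variables (R : comNzRingType) (c n : nat).
Implicit Types (e : mexp c) (A : {set 'I_n}) (h : mexp c -> ext R n).

(** The degree of [e^(e) (x) e'_A]. Everywhere below, degrees separate the
    components: a component in the wrong degree vanishes. *)
Definition bideg e A : nat := (2 * (\sum_l e l) + #|A|)%N.

Lemma bideg_basis k (b : res_basis c n k) : (bideg (res_exp b) (res_set b))%:Z = k.
Proof.
rewrite -[RHS](eqP (valP b)) /bideg; congr (Posz (2 * _ + _)).
by apply: eq_bigr => l _; rewrite ffunE.
Qed.

Lemma basis_of_bideg k e A : (bideg e A)%:Z = k ->
  exists b : res_basis c n k, res_exp b = e /\ res_set b = A.
Proof.
move=> degk; have el l : (e l < (absz k).+1)%N.
  rewrite ltnS -degk /bideg (bigD1 l) //=; lia.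
have P : ((2 * (\sum_l [ffun l => Ordinal (el l)] l) + #|A|)%N%:Z == k).
  apply/eqP; rewrite -[RHS]degk; congr (Posz (2 * _ + _)).
  by apply: eq_bigr => l _; rewrite ffunE.
exists (exist _ ([ffun l => Ordinal (el l)], A) P); split=> //.
by apply/ffunP => l; rewrite !ffunE.
Qed.

Lemma res_basis_inj k (b b' : res_basis c n k) :
  res_exp b = res_exp b' -> res_set b = res_set b' -> b = b'.
Proof.
move=> Ee Es; apply: val_inj; case: b b' Ee Es => [[e A] ?] [[e' A'] ?] Ee.
rewrite /res_set /= => ->; congr (_, _); apply/ffunP => l; apply: val_inj.
by move/ffunP: Ee => /(_ l); rewrite !ffunE.
Qed.

Definition mk_res k h : res_ob R c n k := [ffun b => h (res_exp b) (res_set b)].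

Lemma res_comp_basis k (x : res_ob R c n k) b :
  res_comp (res_exp b) x (res_set b) = x b.
Proof.
rewrite ffunE (bigD1 b) ?eqxx //= big1 ?addr0 // => b' /andP[/andP[/eqP Ee /eqP Es]].
by rewrite (res_basis_inj Ee Es) eqxx.
Qed.

Lemma res_comp_out k (x : res_ob R c n k) e A :
  (bideg e A)%:Z <> k -> res_comp e x A = 0.
Proof.
move=> ne; rewrite ffunE big1 // => b /andP[/eqP Ee /eqP Es].
by case: ne; rewrite -Ee -Es bideg_basis.
Qed.

Lemma res_comp_mk k h e A : (bideg e A)%:Z = k -> res_comp e (mk_res k h) A = h e A.
Proof.
by move=> /basis_of_bideg[b [<- <-]]; rewrite res_comp_basis ffunE.
Qed.

Definition res_delta k (b : res_basis c n k) : res_ob R c n k :=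
  [ffun b' => (b' == b)%:R].

Lemma res_delta_at k (b b' : res_basis c n k) : res_delta b b' = (b' == b)%:R.
Proof. by rewrite ffunE. Qed.

Lemma res_deltaE k (x : res_ob R c n k) : x = \sum_b x b *: res_delta b.
Proof.
apply/ffunP => b; rewrite sum_ffunE (bigD1 b) //= big1 => [|b' bb'].
  by rewrite !ffunE eqxx addr0 /GRing.scale /= mulr1.
by rewrite !ffunE eq_sym (negPf bb') scaler0.
Qed.

Lemma res_comp_delta k (b : res_basis c n k) e :
  res_comp e (res_delta b) = if e == res_exp b then ext_delta R (res_set b) else 0.
Proof.
apply/ffunP => A; case: eqP => [->|ne]; rewrite ffunE.
  under eq_bigr do rewrite ffunE.
  rewrite [RHS]ffunE; case: eqP => [->|nA].
    rewrite (bigD1 b) ?eqxx //= big1 ?addr0 // => b' /andP[_ /negPf->] //.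
  rewrite big1 // => b' /andP[_ /eqP Es]; case: eqP => // Eb.
  by case: nA; rewrite -Es Eb.
rewrite [RHS]ffunE big1 // => b' /andP[/eqP Ee _]; rewrite ffunE.
by case: eqP => // Eb; case: ne; rewrite -Ee Eb.
Qed.

Lemma sum_basis_comp k (x : res_ob R c n k) e (h : {set 'I_n} -> R) :
  \sum_b (if res_exp b == e then x b * h (res_set b) else 0)
  = \sum_A res_comp e x A * h A.
Proof.
under [RHS]eq_bigr do rewrite ffunE mulr_suml.
rewrite [RHS](exchange_big_dep xpredT) //=; under [RHS]eq_bigr => b _.
  rewrite big_mkcond (bigD1 (res_set b)) //= eqxx andbT big1 => [|A nA]; last first.
    by rewrite (eq_sym (res_set b)) (negPf nA) andbF.
  rewrite addr0; over.
by apply: eq_bigr.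
Qed.

End Bases.

Section FullDifferentials.
Variables (R : comNzRingType) (c n : nat) (f : 'I_n -> R) (av : nat -> 'I_n -> R).
Implicit Types (e : mexp c) (A : {set 'I_n}) (u : mexp c -> ext R n).

(** The differentials of the resolution and of its dual, without the restriction
    to one degree. The dual of interior multiplication is exterior multiplication
    and conversely, and the dual of lowering exponents is raising them. *)
Definition res_full : (mexp c -> ext R n) -> mexp c -> ext R n :=
  total_diff (@koszul_diff R n f) (fun l => vec_wedge (av l)) true (k := c).

Definition cores_full : (mexp c -> ext R n) -> mexp c -> ext R n :=
  total_diff (vec_wedge f) (fun l => @koszul_diff R n (av l)) false (k := c).

Lemma res_fullE u e : res_full u e =
  koszul_diff f (u e) + \sum_(l < c) vec_wedge (av l) (u (exp_succ e l)).
Proof. by []. Qed.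

Lemma cores_fullE u e : cores_full u e = vec_wedge f (u e)
  + \sum_(l < c) koszul_diff (av l) (if e l == 0%N then 0 else u (exp_pred e l)).
Proof.
rewrite /cores_full /total_diff; congr (_ + _); apply: eq_bigr => l _.
by rewrite /shift /exp_shift; case: ifP.
Qed.

Lemma bidegU e A i : i \notin A -> bideg e (i |: A) = (bideg e A).+1.
Proof. by move=> iA; rewrite /bideg cardsU1 iA; lia. Qed.

Lemma bidegD e A i : i \in A -> bideg e A = (bideg e (A :\ i)).+1.
Proof. by move=> iA; rewrite /bideg (cardsD1 i A) iA; lia. Qed.

Lemma bideg_succ e l A : bideg (exp_succ e l) A = (bideg e A).+2.
Proof. by rewrite /bideg sum_succ; lia. Qed.

Lemma bideg_pred e (l : 'I_c) A : e l != 0%N -> bideg e A = (bideg (exp_pred e l) A).+2.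
Proof. by move=> el; rewrite -{1}(predK el) bideg_succ. Qed.

(** Passing to one homogeneous component loses nothing. *)
Lemma res_full_local u u' e A :
  (forall e' A', bideg e' A' = (bideg e A).+1 -> u e' A' = u' e' A') ->
  res_full u e A = res_full u' e A.
Proof.
move=> E; rewrite !res_fullE ffunE [RHS]ffunE; congr (_ + _).
  by rewrite !koszul_diffE; apply: eq_bigr => i iA; rewrite E // bidegU.
rewrite !sum_ffunE; apply: eq_bigr => l _; rewrite !vec_wedgeE.
apply: eq_bigr => i iA; rewrite E //.
by apply: succn_inj; rewrite -(bidegD _ iA) bideg_succ.
Qed.

Lemma cores_full_local u u' e A :
  (forall e' A', bideg e A = (bideg e' A').+1 -> u e' A' = u' e' A') ->
  cores_full u e A = cores_full u' e A.
Proof.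
move=> E; rewrite !cores_fullE ffunE [RHS]ffunE; congr (_ + _).
  by rewrite !vec_wedgeE; apply: eq_bigr => i iA; rewrite E // -bidegD.
rewrite !sum_ffunE; apply: eq_bigr => l _; case: ifPn => // el; rewrite !koszul_diffE.
by apply: eq_bigr => i iA; rewrite E // bidegU // -bideg_pred.
Qed.

Variables (al : 'I_c -> ext R n).
Hypothesis alE : forall l : 'I_c, al l = ext_vec (av l).

Notation F := (tate_shamash f al).

Lemma cxdFE i j (x : F i) b :
  (cxd F i j x : res_ob R c n j) b
  = res_full (fun e => res_comp e x) (res_exp b) (res_set b).
Proof.
rewrite tate_shamashE ffunE res_fullE; congr ((_ + _ : ext R n) _).
by apply: eq_bigr => l _; rewrite alE.
Qed.

Definition dual_coords k (y : dual (res_ob R c n k)) : res_ob R c n k :=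
  [ffun b => (y : 'Hom(_, R^o)) (res_delta R b)].

Definition mk_dual k (y : res_ob R c n k) : 'Hom(res_ob R c n k, R^o) :=
  linfun (fun x : res_ob R c n k => \sum_b y b * x b : R^o).

Lemma mk_dualE k (y x : res_ob R c n k) : mk_dual y x = \sum_b y b * x b.
Proof.
rewrite /mk_dual linfun_linear // => s u v; rewrite scaler_sumr -big_split.
by apply: eq_bigr => b _; rewrite !ffunE /GRing.scale /=; ring.
Qed.

Lemma dual_coordsE k (y : 'Hom(res_ob R c n k, R^o)) x :
  y x = \sum_b dual_coords y b * x b.
Proof.
rewrite {1}(res_deltaE x) linear_sum; apply: eq_bigr => b _.
by rewrite linearZ ffunE /GRing.scale /= mulrC.
Qed.

Lemma mk_dualK k (y : res_ob R c n k) : dual_coords (mk_dual y) = y.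
Proof.
apply/ffunP => b; rewrite ffunE mk_dualE (bigD1 b) //= big1 => [|b' bb'].
  by rewrite ffunE eqxx mulr1 addr0.
by rewrite ffunE (negPf bb') mulr0.
Qed.

Lemma dual_eq k (y y' : 'Hom(res_ob R c n k, R^o)) :
  dual_coords y = dual_coords y' -> y = y'.
Proof. by move=> E; apply/lfunP => x; rewrite !dual_coordsE E. Qed.

Lemma pair_delta (x : ext R n) A : pair_ext x (ext_delta R A) = x A.
Proof.
rewrite /pair_ext (bigD1 A) //= big1 => [|B BA]; first by rewrite ffunE eqxx mulr1 addr0.
by rewrite ffunE (negPf BA) mulr0.
Qed.

Lemma pair_extC (x y : ext R n) : pair_ext x y = pair_ext y x.
Proof. by apply: eq_bigr => A _; rewrite mulrC. Qed.

(** The coordinates of the transpose of the differential; this is where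
    [cores_full] comes from. *)
Lemma dual_diff i j (y : 'Hom(res_ob R c n j, R^o)) (b : res_basis c n i) :
  y (cxd F i j (res_delta R b)) =
  cores_full (fun e => res_comp e (dual_coords y)) (res_exp b) (res_set b).
Proof.
rewrite dual_coordsE cores_fullE.
set e := res_exp b; set A := res_set b; set z := dual_coords y.
transitivity (\sum_b' ((if res_exp b' == e
      then z b' * koszul_diff f (ext_delta R A) (res_set b') else 0)
  + \sum_(l < c) if exp_succ (res_exp b') l == e
      then z b' * vec_wedge (av l) (ext_delta R A) (res_set b') else 0)).
  apply: eq_bigr => b' _; rewrite cxdFE res_fullE [X in z b' * X]ffunE mulrDr.
  congr (_ + _).
    by rewrite res_comp_delta; case: eqP => // _; rewrite linear0 [X in _ * X]ffunE mulr0.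
  rewrite sum_ffunE mulr_sumr; apply: eq_bigr => l _; rewrite res_comp_delta.
  by case: eqP => // _; rewrite linear0 [X in _ * X]ffunE mulr0.
rewrite big_split /= exchange_big /= [RHS]ffunE sum_ffunE; congr (_ + _).
  rewrite sum_basis_comp -/(pair_ext _ _) pair_extC koszul_diff_adjoint pair_extC.
  by rewrite pair_delta.
apply: eq_bigr => l _; case: ifPn => el.
  rewrite linear0 ffunE big1 // => b' _; case: eqP => // E.
  by move: el; rewrite -E ffunE eqxx addn1.
rewrite -(pair_delta _ A) koszul_diff_adjoint -/(pair_ext _ _) /pair_ext -sum_basis_comp.
apply: eq_bigr => b' _; congr (if _ then _ else _).
by apply/eqP/eqP => [<-|->]; rewrite ?succK ?predK.
Qed.

End FullDifferentials.

(** * Homology of the resolution and of its dual *)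

Section BaseChange.
Variables (S R : comNzRingType) (p : {rmorphism S -> R}) (n : nat).
Implicit Types (x y : ext S n) (v : 'I_n -> S).

Lemma ext_mapD x y : ext_map p (x + y) = ext_map p x + ext_map p y.
Proof. by apply/ffunP => A; rewrite !ffunE rmorphD. Qed.

Lemma ext_mapZ s x : ext_map p (s *: x) = p s *: ext_map p x.
Proof. by apply/ffunP => A; rewrite !ffunE rmorphM. Qed.

Lemma ext_map0 : ext_map p (0 : ext S n) = 0.
Proof. by apply/ffunP => A; rewrite !ffunE rmorph0. Qed.

Lemma ext_mapN x : ext_map p (- x) = - ext_map p x.
Proof. by apply/ffunP => A; rewrite !ffunE rmorphN. Qed.

Lemma ext_map_sum I (r : seq I) (F : I -> ext S n) :
  ext_map p (\sum_(i <- r) F i) = \sum_(i <- r) ext_map p (F i).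
Proof.
elim/big_ind2: _ => // [|x x' y y' <- <-]; first exact: ext_map0.
exact: ext_mapD.
Qed.

Lemma ext_map1 : ext_map p (ext1 S n) = ext1 R n.
Proof. by apply/ffunP => A; rewrite !ffunE rmorph_nat. Qed.

Lemma ext_map_vec v : ext_map p (ext_vec v) = ext_vec (fun i => p (v i)).
Proof.
apply/ffunP => A; rewrite !ffunE rmorph_sum; apply: eq_bigr => i _.
by rewrite rmorphM rmorph_nat.
Qed.

Lemma ext_map_koszul v x :
  ext_map p (koszul_diff v x) = koszul_diff (fun i => p (v i)) (ext_map p x).
Proof.
apply/ffunP => A; rewrite ffunE !koszul_diffE rmorph_sum; apply: eq_bigr => i _.
by rewrite ffunE !rmorphM rmorphXn rmorphN1.
Qed.

Lemma ext_map_vec_wedge v x :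
  ext_map p (vec_wedge v x) = vec_wedge (fun i => p (v i)) (ext_map p x).
Proof.
apply/ffunP => A; rewrite ffunE !vec_wedgeE rmorph_sum; apply: eq_bigr => i _.
by rewrite ffunE !rmorphM rmorphXn rmorphN1.
Qed.

Variables (c : nat) (f : 'I_n -> S) (av : nat -> 'I_n -> S).

Lemma ext_map_res (u : mexp c -> ext S n) e :
  ext_map p (res_full f av u e) =
  res_full (fun i => p (f i)) (fun l i => p (av l i)) (fun e => ext_map p (u e)) e.
Proof.
rewrite !res_fullE ext_mapD ext_map_koszul ext_map_sum; congr (_ + _).
by apply: eq_bigr => l _; rewrite ext_map_vec_wedge.
Qed.

Lemma ext_map_cores (u : mexp c -> ext S n) e :
  ext_map p (cores_full f av u e) =
  cores_full (fun i => p (f i)) (fun l i => p (av l i)) (fun e => ext_map p (u e)) e.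
Proof.
rewrite !cores_fullE ext_mapD ext_map_vec_wedge ext_map_sum; congr (_ + _).
apply: eq_bigr => l _; rewrite ext_map_koszul; congr (koszul_diff _ _).
by case: ifP => // _; rewrite ext_map0.
Qed.

End BaseChange.

Section Transfer.
Variables (S R : comNzRingType) (p : {rmorphism S -> R}) (c n : nat).
Variables (g : 'I_c -> S) (f : 'I_n -> S) (a : 'M[S]_(n, c)).
Hypotheses (hg : regular_sequence g) (hf : regular_sequence f).
Hypothesis p_surj : forall r, exists s, p s = r.
Hypothesis p_ker : forall s, p s = 0 <-> ideal_gen g s.
Hypothesis ha : forall j, g j = \sum_i a i j * f i.

(** Families extended by [0] to all natural numbers. *)
Definition gnat (l : nat) : S := if insub l is Some l' then g l' else 0.
Definition anat (l : nat) (i : 'I_n) : S := if insub l is Some l' then a i l' else 0.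

Lemma gnatE l : gnat l = \sum_i anat l i * f i.
Proof.
rewrite /gnat /anat; case: insubP => [l' _ _|_]; first exact: ha.
by rewrite big1 // => i _; rewrite mul0r.
Qed.

Lemma gnat_ord (l : 'I_c) : gnat l = g l. Proof. by rewrite /gnat valK. Qed.

Lemma in_prefix_coords k (x : ext S n) :
  in_prefix gnat k x <-> forall A, exists b : nat -> S, x A = \sum_(l < k) b l * gnat l.
Proof.
split=> [[y ->] A|xA].
  exists (fun l => y l A); rewrite sum_ffunE; apply: eq_bigr => l _.
  by rewrite ffunE /GRing.scale /= mulrC.
have [b bP] := choice xA; exists (fun l => [ffun A => b A l]).
apply/ffunP => A; rewrite bP sum_ffunE; apply: eq_bigr => l _.
by rewrite !ffunE /GRing.scale /= mulrC.
Qed.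

Lemma in_prefix_regular k (x : ext S n) : (k < c)%N ->
  in_prefix gnat k (gnat k *: x) -> in_prefix gnat k x.
Proof.
move=> kc /in_prefix_coords G; apply/in_prefix_coords => A.
have W (b : nat -> S) : \sum_(l < k) b l * gnat l =
    \sum_(l < c | (l < Ordinal kc)%N) b l * g l.
  rewrite (big_ord_widen c (fun l => b l * gnat l)) ?(ltnW kc) //.
  by apply: eq_bigr => l _; rewrite gnat_ord.
have [b] := G A; rewrite ffunE /GRing.scale /= W (gnat_ord (Ordinal kc)) => E.
have [|b' ->] := proj2 hg (Ordinal kc) (x A); first by exists (fun l => b l).
pose b'' l := if insub l is Some l' then b' l' else 0; exists b''; rewrite W.
by apply: eq_bigr => l _; rewrite /b'' valK.
Qed.

Lemma in_prefix_ker (x : ext S n) : in_prefix gnat c x <-> ext_map p x = 0.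
Proof.
split=> [/in_prefix_coords G|E].
  apply/ffunP => A; rewrite !ffunE; apply/p_ker; have [b ->] := G A.
  by exists b; apply: eq_bigr => l _; rewrite gnat_ord.
apply/in_prefix_coords => A.
have /p_ker[b ->] : p (x A) = 0 by have /ffunP/(_ A) := E; rewrite !ffunE.
exists (fun l => if insub l is Some l' then b l' else 0).
by apply: eq_bigr => l _; rewrite valK gnat_ord.
Qed.

(** Lifts from [R] to [S] can send [0] to [0], which preserves supports. *)
Lemma section_exists : exists sg : R -> S, sg 0 = 0 /\ forall r, p (sg r) = r.
Proof.
have [sg sgP] := choice p_surj; exists (fun r => if r == 0 then 0 else sg r).
by split=> [|r]; rewrite ?eqxx //; case: eqP => [->|_]; rewrite ?rmorph0.
Qed.

Lemma lift_comp k (x : res_ob R c n k) : exists u : mexp c -> ext S n,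
  (forall e, ext_map p (u e) = res_comp e x) /\ admissible true u.
Proof.
have [sg [sg0 sgK]] := section_exists.
exists (fun e => [ffun A => sg (res_comp e x A)]); split.
  by move=> e; apply/ffunP => A; rewrite 2!ffunE sgK.
move=> _; exists (absz k).+1 => e ke; apply/ffunP => A.
rewrite ffunE [RHS]ffunE res_comp_out // /bideg => E.
by move: ke; rewrite -E; lia.
Qed.

(** The functional [b |-> (alpha /\ b)_top] up to sign, see [dual_generatorE]. *)
Definition dual_generator : mexp c -> ext S n :=
  generator (fun l => @koszul_diff S n (anat l)) (unstar (ext1 S n)) false (k := c).

Definition res_generator : mexp c -> ext S n :=
  generator (fun l => vec_wedge (anat l)) (ext1 S n) true (k := c).

Lemma res_generatorE e A : res_generator e A = ((e == exp0 c) && (A == set0))%:R.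
Proof.
rewrite /res_generator /generator; case: eqP => _ /=; last by rewrite ffunE.
have -> k : gen_coef (fun l => vec_wedge (anat l)) (ext1 S n) true k = ext1 S n.
  by elim: k.
by rewrite ffunE.
Qed.

(** Each of the [c] interior products lowers the degree [n] of the top element. *)
Lemma dual_generator_degree e A : (bideg e A + c != n)%N -> dual_generator e A = 0.
Proof.
rewrite /dual_generator /generator; case: (e =P exp0 c) => [->|_ _];
  last by rewrite ffunE.
rewrite /bideg big1 ?muln0 ?add0n => [|l _]; last by rewrite ffunE.
elim: c A => [|k IH] A /=.
  rewrite addn0 ffunE => An; rewrite [ext1 _ _ _]ffunE.
  case: eqP => [A0|]; last by rewrite mulr0.
  by move: An; rewrite -[A]setCK A0 setC0 cardsT card_ord eqxx.
move=> An; rewrite koszul_diffE big1 // => i iA; rewrite IH ?mulr0 //.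
by rewrite cardsU1 iA; move: An; rewrite addnS addSn.
Qed.

Lemma res_full_lift (u : mexp c -> ext S n) :
  admissible true u -> (forall e, ext_map p (res_full f anat u e) = 0) ->
  exists s v, forall e,
    ext_map p (u e) = ext_map p (s *: res_generator e + res_full f anat v e).
Proof.
move=> au Du.
have [||||||||s [v [_ sv]]] := @cycles_lift_all S (ext S n) c (@koszul_diff S n f)
  (fun l => vec_wedge (anat l)) gnat (ext1 S n) _ _ _ _ _ _ _ true c (leqnn c) u au.
- exact: koszul_diffK.
- by move=> l x; apply: vec_wedgeK.
- by move=> l l' x; apply: vec_wedge_anti.
- by move=> l x; rewrite koszul_diff_vec_wedge -gnatE.
- exact: koszul_diff1.
- exact: koszul_acyclic.
- exact: in_prefix_regular.
- by move=> e; apply/in_prefix_ker; apply: Du.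
exists s, v => e; have /in_prefix_ker := sv e.
have -> : (u - s *: res_generator - res_full f anat v) e =
    u e - (s *: res_generator e + res_full f anat v e).
  transitivity (u e - s *: res_generator e - res_full f anat v e) => //.
  linear_identity.
by rewrite ext_mapD ext_mapN => /eqP; rewrite subr_eq0 => /eqP.
Qed.

Let comm_rel l (x : ext S n) :
  vec_wedge f (koszul_diff (anat l) x) + koszul_diff (anat l) (vec_wedge f x)
  = gnat l *: x.
Proof.
rewrite addrC koszul_diff_vec_wedge gnatE; congr (_ *: _).
by apply: eq_bigr => i _; rewrite mulrC.
Qed.

Let f_top : vec_wedge f (unstar (ext1 S n)) = 0.
Proof. by rewrite -unstar_koszul_diff koszul_diff1 linear0. Qed.

Lemma cores_full_lift (u : mexp c -> ext S n) :
  (forall e, ext_map p (cores_full f anat u e) = 0) ->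
  exists s v, forall e,
    ext_map p (u e) = ext_map p (s *: dual_generator e + cores_full f anat v e).
Proof.
move=> Du.
have [|||||||||s [v [_ sv]]] := @cycles_lift_all S (ext S n) c (vec_wedge f)
  (fun l => @koszul_diff S n (anat l)) gnat (unstar (ext1 S n)) _ _ _ _ _ _ _
  false c (leqnn c) u _.
- exact: vec_wedgeK.
- by move=> l x; apply: koszul_diffK.
- by move=> l l' x; apply: koszul_diff_anti.
- exact: comm_rel.
- exact: f_top.
- exact: vec_wedge_acyclic.
- exact: in_prefix_regular.
- by [].
- by move=> e; apply/in_prefix_ker; apply: Du.
exists s, v => e; have /in_prefix_ker := sv e.
have -> : (u - s *: dual_generator - cores_full f anat v) e =
    u e - (s *: dual_generator e + cores_full f anat v e).
  transitivity (u e - s *: dual_generator e - cores_full f anat v e) => //.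
  linear_identity.
by rewrite ext_mapD ext_mapN => /eqP; rewrite subr_eq0 => /eqP.
Qed.

Lemma cores_full_augment s (v : mexp c -> ext S n) :
  (forall e, ext_map p (s *: dual_generator e) = ext_map p (cores_full f anat v e)) ->
  ideal_gen f s.
Proof.
move=> E.
apply: (@augmented_all S (ext S n) c (vec_wedge f)
  (fun l => @koszul_diff S n (anat l)) gnat (unstar (ext1 S n)) _ _ _ _ _ _
  false (ideal_gen f) c erefl (leqnn c) _ s v).
- exact: vec_wedgeK.
- by move=> l x; apply: koszul_diffK.
- by move=> l l' x; apply: koszul_diff_anti.
- exact: comm_rel.
- exact: f_top.
- exact: in_prefix_regular.
- exact: vec_wedge_augment.
- by [].
move=> e; apply/in_prefix_ker.
have -> : (s *: dual_generator - cores_full f anat v) e =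
  s *: dual_generator e - cores_full f anat v e by [].
by rewrite ext_mapD ext_mapN E subrr.
Qed.

Notation fR := (fun i => p (f i)).
Notation aR := (fun l i => p (anat l i)).
Notation F := (tate_shamash_quot p f a).

Lemma alphaE (l : 'I_c) : ext_map p (alpha_vec a l) = ext_vec (aR l).
Proof.
rewrite /alpha_vec ext_map_vec; apply/ffunP => A; rewrite !ffunE.
by apply: eq_bigr => i _; rewrite /anat valK.
Qed.

Lemma resE i j (x : F i) b : (cxd F i j x : res_ob R c n j) b
  = res_full fR aR (fun e => res_comp e x) (res_exp b) (res_set b).
Proof. by apply: cxdFE; exact: alphaE. Qed.

Lemma dual_resE i j (y : 'Hom(res_ob R c n j, R^o)) (b : res_basis c n i) :
  y (cxd F i j (res_delta R b)) =
  cores_full fR aR (fun e => res_comp e (dual_coords y)) (res_exp b) (res_set b).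
Proof. by apply: dual_diff; exact: alphaE. Qed.

Lemma res_full0 e : res_full fR aR (fun=> 0 : ext R n) (e : mexp c) = 0.
Proof. by rewrite res_fullE linear0 big1 ?addr0 // => l _; rewrite linear0. Qed.

Lemma cores_full0 e : cores_full fR aR (fun=> 0 : ext R n) (e : mexp c) = 0.
Proof.
rewrite cores_fullE linear0 big1 ?addr0 // => l _.
by case: ifP => _; rewrite linear0.
Qed.

Lemma res_cycle_full (i : int) (x : F i) : Defs.cycle x ->
  forall e, res_full fR aR (fun e => res_comp e x) e = 0.
Proof.
move=> dx e; apply/ffunP => A; rewrite [RHS]ffunE.
have [E|ne] := pselect ((bideg e A)%:Z = i - 1).
  have [b [<- <-]] := basis_of_bideg E.
  by rewrite -resE dx ffunE.
rewrite (@res_full_local _ _ _ _ _ _ (fun=> 0)) ?res_full0 ?ffunE // => e' A' E.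
by rewrite res_comp_out ?ffunE // => E'; case: ne; rewrite -E' E; lia.
Qed.

(** A cycle over [R] is lifted to [S], where the differential vanishes only modulo
    the [g_l]; the description of such lifts is then reduced to [R] and to the
    degree in question. *)
Lemma res_cycle (i : int) (x : F i) : Defs.cycle x -> exists s (y : F (i + 1)),
  forall b : res_basis c n i, (x : res_ob R c n i) b =
    p s * ((res_exp b == exp0 c) && (res_set b == set0))%:R
    + (cxd F (i + 1) i y : res_ob R c n i) b.
Proof.
move=> /res_cycle_full dx; have [u [uE au]] := lift_comp x.
have [|s [v sv]] := res_full_lift au.
  by move=> e; rewrite ext_map_res -(dx e); congr res_full; apply/funext => e'.
exists s, (mk_res (i + 1) (fun e => ext_map p (v e))) => b.
rewrite -{1}res_comp_basis -uE sv ext_mapD ext_mapZ ext_map_res ffunE.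
congr (_ + _); first by rewrite !ffunE res_generatorE rmorph_nat.
rewrite resE; apply: res_full_local => e A E; rewrite res_comp_mk //.
by rewrite E -[in RHS](bideg_basis b); lia.
Qed.

Lemma dual_cycle_full (k : int) (y : 'Hom(res_ob R c n k, R^o)) :
  (forall x : F (k + 1), y (cxd F (k + 1) k x) = 0) ->
  forall e, cores_full fR aR (fun e => res_comp e (dual_coords y)) e = 0.
Proof.
move=> dy e; apply/ffunP => A; rewrite [RHS]ffunE.
have [E|ne] := pselect ((bideg e A)%:Z = k + 1).
  have [b [<- <-]] := basis_of_bideg E.
  by rewrite -dual_resE dy.
rewrite (@cores_full_local _ _ _ _ _ _ (fun=> 0)) ?cores_full0 ?ffunE // => e' A' E.
by rewrite res_comp_out ?ffunE // => E'; case: ne; rewrite -E' E; lia.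
Qed.

Lemma dual_cycle (k : int) (y : 'Hom(res_ob R c n k, R^o)) :
  (forall x : F (k + 1), y (cxd F (k + 1) k x) = 0) ->
  exists s (z : 'Hom(res_ob R c n (k - 1), R^o)), forall b : res_basis c n k,
    y (res_delta R b) = p s * p (dual_generator (res_exp b) (res_set b))
                        + z (cxd F k (k - 1) (res_delta R b)).
Proof.
move=> /dual_cycle_full dy; have [u [uE _]] := lift_comp (dual_coords y).
have [|s [v sv]] := @cores_full_lift u.
  by move=> e; rewrite ext_map_cores -(dy e); congr cores_full; apply/funext => e'.
exists s, (mk_dual (mk_res (k - 1) (fun e => ext_map p (v e)))) => b.
have -> : y (res_delta R b) = dual_coords y b by rewrite ffunE.
rewrite -res_comp_basis -uE sv ext_mapD ext_mapZ ext_map_cores ffunE.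
congr (_ + _); first by rewrite !ffunE.
rewrite dual_resE mk_dualK; apply: cores_full_local => e A E; rewrite res_comp_mk //.
by move: (bideg_basis b); rewrite E => <-; lia.
Qed.

(** The multiples of the generator that bound are those by elements of [J]. *)
Lemma dual_augment s (z : 'Hom(res_ob R c n (n%:Z - c%:Z - 1), R^o)) :
  (forall b : res_basis c n (n%:Z - c%:Z),
     p s * p (dual_generator (res_exp b) (res_set b))
     = z (cxd F (n%:Z - c%:Z) (n%:Z - c%:Z - 1) (res_delta R b))) ->
  ideal_gen f s.
Proof.
move=> E; have [u [uE _]] := lift_comp (dual_coords z).
apply: (@cores_full_augment s u) => e; rewrite ext_map_cores ext_mapZ.
have -> : (fun e => ext_map p (u e)) = (fun e => res_comp e (dual_coords z)).
  by apply/funext => e'.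
apply/ffunP => A; rewrite ffunE [ext_map _ _ _]ffunE.
have [D|ne] := pselect ((bideg e A)%:Z = n%:Z - c%:Z).
  have [b [<- <-]] := basis_of_bideg D.
  by rewrite -dual_resE -E.
rewrite dual_generator_degree ?rmorph0 ?scaler0; last by apply/eqP => D; case: ne; lia.
rewrite (@cores_full_local _ _ _ _ _ _ (fun=> 0)) ?cores_full0 ?ffunE // => e' A' D.
by rewrite res_comp_out ?ffunE // => D'; case: ne; rewrite D; lia.
Qed.

End Transfer.

(** * Mapping cones *)

Section Complexes.
Variable R : comNzRingType.
Implicit Types C D : cxdata R.

Lemma dual_shift_complex C N : is_complex C -> is_complex (dual_shift C N).
Proof.
move=> [C0 CC]; split=> [i j ij|i j k].
  apply/lfunP => y; rewrite zero_lfunE; apply/lfunP => x.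
  rewrite [LHS]dual_mapE C0; first by rewrite !zero_lfunE linear0.
  by apply: contraNneq ij => E; apply/eqP; lia.
apply/lfunP => y; rewrite comp_lfunE zero_lfunE; apply/lfunP => x.
rewrite [LHS]dual_mapE [LHS]dual_mapE zero_lfunE.
by rewrite -[cxd C _ _ (cxd C _ _ x)]comp_lfunE CC zero_lfunE linear0.
Qed.

Lemma cxd_sq C : is_complex C -> forall i j k x, cxd C j k (cxd C i j x) = 0.
Proof. by move=> [_ CC] i j k x; rewrite -comp_lfunE CC zero_lfunE. Qed.

Lemma boundary_cycle C i (x : C i) : is_complex C -> boundary x -> Defs.cycle x.
Proof. by move=> cC [y <-]; apply: cxd_sq. Qed.

Section Cone.
Variables (C D : cxdata R) (psi : forall i j, 'Hom(C i, D j)).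
Hypothesis psi_chain : chain_map psi.

Let cC : is_complex C. Proof. by case: psi_chain. Qed.
Let cD : is_complex D. Proof. by case: psi_chain. Qed.

(** With free indices, so that degrees equal but not convertible, such as [i] and
    [i - 1 + 1], can be used side by side. *)
Lemma chain_mapE i j i' j' : i' = i -> j = i - 1 -> j' = j -> forall x : C i,
  cxd D i' j' (psi i i' x) = psi j j' (cxd C i j x).
Proof.
move=> -> -> -> x; case: psi_chain => _ _ _ /(_ i) /lfunP/(_ x).
by rewrite !comp_lfunE.
Qed.

Lemma cone_complex : is_complex (cone psi).
Proof.
have [[C0 _] [D0 _] P0 _] := psi_chain.
split=> [i j ij|i j k]; apply/lfunP => -[x y].
  rewrite [LHS]cone_mapE zero_lfunE C0 // P0 // D0; last first.
    by apply: contraNneq ij => /addIr->.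
  by rewrite !zero_lfunE subr0.
rewrite comp_lfunE [cxd (cone psi) i j _]cone_mapE [LHS]cone_mapE zero_lfunE.
congr (_, _); first exact: cxd_sq.
rewrite linearB /= (cxd_sq cD) subr0.
suff -> : psi j (k + 1) (cxd C i j x) = cxd D (j + 1) (k + 1) (psi i (j + 1) x).
  by rewrite subrr.
have [E|ij] := eqVneq i (j + 1); last first.
  by rewrite C0 // (P0 i) // !zero_lfunE !linear0.
have [E'|jk] := eqVneq j (k + 1); last first.
  rewrite P0 // D0 ?zero_lfunE //.
  by apply: contraNneq jk => /addIr ->.
by rewrite (chain_mapE (j := j)) //; lia.
Qed.

Hypothesis psi_iso : forall i, iso_on_homology psi i.

(** If [(x, y)] is a cycle then [psi x] is a boundary, so [x = d x']; then
    [psi x' - y] is a cycle of [D], which is [psi x''] up to a boundary for a cycle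
    [x''], and [x' - x''] has the required image. *)
Lemma cone_exact i : exact_at (cone psi) i.
Proof.
move=> xy; split; last exact: (boundary_cycle cone_complex).
case: xy => x y; rewrite /Defs.cycle [X in X = _ -> _]cone_mapE => -[dx].
move=> /eqP; rewrite subr_eq0 => /eqP psix.
have bx : boundary (psi i i x).
  exists y; move: psix; have : i - 1 + 1 = i by rewrite subrK.
  by move: (i - 1 + 1) => j ->.
have [x' dx'] := (psi_iso i).1 x dx bx.
pose z := psi (i + 1) (i + 1) x' - y.
have cz : Defs.cycle z.
  rewrite /Defs.cycle linearB /= (chain_mapE (j := i + 1 - 1)) //.
  have : cxd D (i + 1) i y = psi i i x.
    move: psix; have : i - 1 + 1 = i by rewrite subrK.
    by move: (i - 1 + 1) => j ->.
  have : i + 1 - 1 = i by rewrite addrK.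
  by move: (i + 1 - 1) => j -> ->; rewrite dx' subrr.
have [x'' [cx'' [y' dy']]] := (psi_iso (i + 1)).2 z cz.
exists (x' - x'', y'); rewrite [LHS]cone_mapE; congr (_, _).
  rewrite linearB /= dx'; have : cxd C (i + 1) (i + 1 - 1) x'' = 0 by [].
  have : i + 1 - 1 = i by rewrite addrK.
  by move: (i + 1 - 1) => j -> ->; rewrite subr0.
by rewrite dy' linearB /= /z opprB addrA subrK opprB addrC subrK.
Qed.

Lemma cone_tate (M : lmodType R) (eps : {linear C 0 -> M}) (N : int) :
  free_resolution eps -> (forall i, N <= i -> forall y : D i, y = 0) ->
  tate_resolution (cone psi) M.
Proof.
move=> Cres DN; split; [exact: cone_complex|exact: cone_exact|].
exists C, eps, N; split=> //.
pose th i : 'Hom(cone psi i, C i) := linfun (fun z : cone psi i => z.1 : C i).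
have thE i z : th i z = z.1 by rewrite /th linfun_linear.
exists th; split=> i Ni.
  exists (fun x => (x, 0) : cone psi i) => [[x y]|x]; rewrite thE //=; congr (_, _).
  by apply/esym/DN; apply: le_trans Ni _; rewrite lerDl.
by apply/lfunP => -[x y]; rewrite !comp_lfunE !thE [X in _ = X.1]cone_mapE.
Qed.

End Cone.
End Complexes.

(** * The map phi *)

Section IteratedWedge.
Variables (R : comNzRingType) (n : nat) (av : nat -> 'I_n -> R).
Implicit Types (x y : ext R n) (v : 'I_n -> R).

(** [alpha_0 /\ (... (alpha_(k-1) /\ x))]. *)
Definition iter_wedge k x := foldr (fun l => vec_wedge (av l)) x (iota 0 k).

Lemma iter_wedgeS k x : iter_wedge k.+1 x = iter_wedge k (vec_wedge (av k) x).
Proof. by rewrite /iter_wedge -addn1 iotaD foldr_cat. Qed.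

Lemma iter_wedge0 k : iter_wedge k 0 = 0.
Proof. by elim: k => // k IH; rewrite iter_wedgeS linear0. Qed.

Lemma iter_wedgeN k x : iter_wedge k (- x) = - iter_wedge k x.
Proof. by elim: k x => // k IH x; rewrite !iter_wedgeS linearN IH. Qed.

Lemma vec_wedge_iter v k x :
  iter_wedge k (vec_wedge v x) = (-1) ^+ k *: vec_wedge v (iter_wedge k x).
Proof.
elim: k x => [|k IH] x; first by rewrite scale1r.
rewrite !iter_wedgeS vec_wedge_anti iter_wedgeN IH exprS; linear_identity.
Qed.

Lemma iter_wedge_last l k x : (l < k)%N -> iter_wedge k (vec_wedge (av l) x) = 0.
Proof.
elim: k x => // k IH x; rewrite ltnS leq_eqVlt iter_wedgeS.
case/orP => [/eqP->|lk]; first by rewrite vec_wedgeK iter_wedge0.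
by rewrite vec_wedge_anti iter_wedgeN IH ?oppr0.
Qed.

Lemma iter_wedge_first l k x : (l < k)%N -> vec_wedge (av l) (iter_wedge k x) = 0.
Proof.
move=> lk; have := vec_wedge_iter (av l) k x; rewrite iter_wedge_last // => /esym E.
by rewrite -[LHS]scale1r -(sqrr_sign R k) expr2 -scalerA E scaler0.
Qed.

Lemma koszul_iter_wedge v k x : (forall l, \sum_i av l i * v i = 0) ->
  koszul_diff v (iter_wedge k x) = (-1) ^+ k *: iter_wedge k (koszul_diff v x).
Proof.
move=> av0; elim: k x => [|k IH] x; first by rewrite scale1r.
have := koszul_diff_vec_wedge v (av k) x; rewrite av0 scale0r => /eqP.
rewrite addr_eq0 !iter_wedgeS IH => /eqP->; rewrite iter_wedgeN exprS; linear_identity.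
Qed.

(** Interior products are adjoint to exterior ones, so the generator of the dual
    pairs with [x] as the top form pairs with [alpha /\ x]. *)
Lemma gen_coef_adjoint (w0 : ext R n) k x :
  pair_ext (gen_coef (fun l => @koszul_diff R n (av l)) w0 false k) x
  = pair_ext w0 (iter_wedge k x).
Proof. by elim: k x => //= k IH x; rewrite koszul_diff_adjoint IH -iter_wedgeS. Qed.

Definition of_degree (i : int) x := forall A : {set 'I_n}, #|A|%:Z <> i -> x A = 0.

Lemma vec_wedge_degree v i x : of_degree i x -> of_degree (i + 1) (vec_wedge v x).
Proof.
move=> xi A Ai; rewrite vec_wedgeE big1 // => j jA; rewrite xi ?mulr0 // => E.
by case: Ai; rewrite (cardsD1 j) jA -E; lia.
Qed.

Lemma iter_wedge_degree k i x : of_degree i x -> of_degree (k%:Z + i) (iter_wedge k x).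
Proof.
elim: k i x => [|k IH] i x xi; first by rewrite add0r.
have -> : k.+1%:Z + i = k%:Z + (i + 1) by lia.
by rewrite iter_wedgeS; apply/IH/vec_wedge_degree.
Qed.

Lemma wedge_degree i j x y : of_degree i x -> of_degree j y ->
  of_degree (i + j) (wedge x y).
Proof.
move=> xi yj C Cij; rewrite ffunE big1 // => A AC.
have cC : #|C| = (#|A| + #|C :\: A|)%N by rewrite -(cardsID A C) (setIidPr AC).
have [Ai|Ai] := eqVneq (#|A|%:Z) i; last by rewrite xi ?mul0r ?mulr0 //; apply/eqP.
by rewrite yj ?mulr0 // => E; case: Cij; rewrite cC -Ai -E.
Qed.

Lemma koszul_top v x : koszul_diff v x setT = 0.
Proof. by rewrite koszul_diffE big1 // => i; rewrite inE. Qed.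

Lemma invol_degree k x : of_degree k%:Z x -> invol x = (-1) ^+ k *: x.
Proof.
move=> xk; apply/ffunP => A; rewrite !ffunE.
have [<-//|Ak] := eqVneq #|A| k.
by rewrite xk ?scaler0 ?mulr0 // => -[E]; rewrite E eqxx in Ak.
Qed.

(** The Leibniz rule in the top degree, where Koszul boundaries vanish. *)
Lemma wedge_koszul_top v k x y : of_degree k%:Z x ->
  wedge x (koszul_diff v y) setT = - (-1) ^+ k * wedge (koszul_diff v x) y setT.
Proof.
move=> /invol_degree xk.
have := congr1 (fun z : ext R n => z setT) (koszul_diff_wedge v x y).
rewrite koszul_top xk wedgeZl /= !ffunE -!/(wedge _ _) => /esym/eqP.
rewrite addrC addr_eq0 => /eqP E.
by rewrite mulNr -mulrN -E /GRing.scale /= mulrA -expr2 sqrr_sign mul1r.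
Qed.

End IteratedWedge.

Section Comparison.
Variables (S R : comNzRingType) (p : {rmorphism S -> R}) (c n : nat).
Variables (g : 'I_c -> S) (f : 'I_n -> S) (a : 'M[S]_(n, c)).
Hypothesis p_ker : forall s, p s = 0 <-> ideal_gen g s.
Hypothesis ha : forall j, g j = \sum_i a i j * f i.
Variable beta : 'Hom(extpow S n n%:Z, S^o).

Notation fR := (fun i => p (f i)).
Notation aR := (fun l i => p (anat a l i)).
Notation F := (tate_shamash_quot p f a).
Notation alR := (ext_map p (alpha a)).
Notation top := [set: 'I_n].

Lemma top_basisP : #|top|%:Z == n%:Z. Proof. by rewrite cardsT card_ord. Qed.
Definition top_basis : ext_basis n n%:Z := exist _ top top_basisP.

Lemma top_basisE (b : ext_basis n n%:Z) : b = top_basis.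
Proof.
have /eqP[E] := valP b; apply: val_inj; apply/eqP.
by rewrite eqEcard subsetT cardsT card_ord [X in (_ <= X)%N]E leqnn.
Qed.

(** [beta] is this unit times the coefficient of [e'_1 /\ ... /\ e'_n]. *)
Definition beta_unit : S := beta [ffun b => (b == top_basis)%:R].

Lemma form_top (y : ext R n) : form_map p beta (ext_pr n%:Z y) = p beta_unit * y top.
Proof.
rewrite form_mapE (bigD1 top_basis) //= big1 ?addr0 => [|b]; last first.
  by rewrite (top_basisE b) eqxx.
by rewrite ffunE mulrC.
Qed.

Lemma beta_unit_inv : bijective beta -> exists u, u * beta_unit = 1.
Proof.
move=> [h _ hK]; exists (h 1 top_basis).
have E : h 1 = h 1 top_basis *: [ffun b => (b == top_basis)%:R].
  apply/ffunP => b; rewrite !ffunE (top_basisE b) eqxx /GRing.scale /= mulr1 //.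
by rewrite -[RHS](hK 1) [in RHS]E linearZ_LR.
Qed.

Lemma alpha_wedge (x : ext R n) : wedge alR x = iter_wedge aR c x.
Proof.
have -> : alpha a = \big[@wedge S n/@ext1 S n]_(j < c) ext_vec (anat a j).
  apply: eq_bigr => j _; rewrite /alpha_vec; apply/ffunP => A; rewrite !ffunE.
  by apply: eq_bigr => i _; rewrite /anat valK.
rewrite -(big_mkord xpredT (fun j => ext_vec (anat a j))) /index_iota subn0.
rewrite /iter_wedge; elim: (iota 0 c) => [|l r IH] /=.
  by rewrite big_nil ext_map1 wedge1x.
by rewrite big_cons -IH [X in wedge X x]ext_map_vec_wedge vec_wedgeA.
Qed.

Lemma ext_in_pr k (x : res_ob R c n k) :
  ext_in (ext_pr k (res_comp (exp0 c) x)) = res_comp (exp0 c) x.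
Proof.
apply/ffunP => A; rewrite [LHS]ffunE.
have [Ak|Ak] := eqVneq (#|A|%:Z) k.
  have AP : #|A|%:Z == k by apply/eqP.
  rewrite (bigD1 (exist _ A AP : ext_basis n k)) ?eqxx //= big1 ?addr0 ?ffunE //.
  by move=> b /andP[/eqP E /eqP[]]; apply: val_inj.
rewrite res_comp_out; last first.
  rewrite /bideg big1 => [|l _]; last by rewrite ffunE.
  by move=> E; case/eqP: Ak.
rewrite big1 // => b /eqP E; have := valP b; rewrite E => E'.
by rewrite E' in Ak.
Qed.

Lemma comp0_degree k (x : res_ob R c n k) : of_degree k (res_comp (exp0 c) x).
Proof.
move=> A Ak; apply: res_comp_out.
by rewrite /bideg big1 => [|l _]; rewrite ?ffunE // muln0.
Qed.

Lemma phiE i j (x : F i) (x' : res_ob R c n (n%:Z - c%:Z - j)) :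
  (phi p f a beta i j x : 'Hom(_, R^o)) x' =
  p beta_unit *
  wedge (wedge alR (res_comp (exp0 c) x)) (res_comp (exp0 c) x') top.
Proof.
rewrite /phi comp_lfunE dual_mapE comp_lfunE phi'E !res_projE form_top.
by rewrite !ext_in_pr.
Qed.

Lemma phi_off_diagonal i j : i != j -> phi p f a beta i j = 0.
Proof.
move=> ij; apply/lfunP => x; apply/lfunP => x'; rewrite phiE !zero_lfunE.
rewrite alpha_wedge.
rewrite (wedge_degree (iter_wedge_degree _ (comp0_degree x)) (comp0_degree x')).
  by rewrite mulr0.
by rewrite cardsT card_ord => E; case/eqP: ij; lia.
Qed.

Lemma gnatR0 l : \sum_i p (anat a l i) * p (f i) = 0.
Proof.
transitivity (p (gnat g l)).
  by rewrite (gnatE ha) rmorph_sum; apply: eq_bigr => i _; rewrite rmorphM.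
rewrite /gnat; case: insub => [l'|]; last exact: rmorph0.
by apply/p_ker; exists (fun k => (k == l')%:R);
  rewrite (bigD1 l') //= eqxx mul1r big1 ?addr0 // => k /negPf->; rewrite mul0r.
Qed.

Lemma res_comp_diff i j (x : F i) e : i = j + 1 ->
  res_comp e (cxd F i j x : res_ob R c n j) = res_full fR aR (fun e => res_comp e x) e.
Proof.
move=> ij; apply/ffunP => A.
have [E|ne] := pselect ((bideg e A)%:Z = j).
  by have [b [<- <-]] := basis_of_bideg E; rewrite res_comp_basis resE.
rewrite res_comp_out // (@res_full_local _ _ _ _ _ _ (fun=> 0)).
  by rewrite res_full0 ffunE.
move=> e' A' E; rewrite res_comp_out ?ffunE // => E'.
by case: ne; move: E'; rewrite E ij; lia.
Qed.

Lemma res_complex : is_complex F.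
Proof.
have offdiag i j : i != j + 1 -> cxd F i j = 0.
  move=> ij; apply/lfunP => x; apply/ffunP => b; rewrite resE zero_lfunE [RHS]ffunE.
  rewrite (@res_full_local _ _ _ _ _ _ (fun=> 0)) ?res_full0 ?ffunE // => e A E.
  rewrite res_comp_out ?ffunE // => E'; case/eqP: ij.
  by have := bideg_basis b; move: E'; rewrite E; lia.
split=> // i j k; have [ij|/offdiag->] := eqVneq i (j + 1); last by rewrite comp_lfun0r.
have [jk|/offdiag->] := eqVneq j (k + 1); last by rewrite comp_lfun0l.
apply/lfunP => x; rewrite comp_lfunE zero_lfunE; apply/ffunP => b.
rewrite resE [RHS]ffunE.
have -> : (fun e => res_comp e (cxd F i j x : res_ob R c n j)) =
    res_full fR aR (fun e => res_comp e x).
  by apply/funext => e; apply: res_comp_diff.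
rewrite /res_full (@total_diffK _ _ _ (fun l => vec_wedge (aR l))
  (fun l => \sum_i p (anat a l i) * p (f i))).
- by rewrite big1 ?ffunE // => l _; rewrite gnatR0 scale0r.
- exact: koszul_diffK.
- by move=> l y; apply: vec_wedgeK.
- by move=> l l' y; apply: vec_wedge_anti.
by move=> l y; apply: koszul_diff_vec_wedge.
Qed.

Lemma res_neg i : i < 0 -> forall x : F i, x = 0.
Proof.
move=> i0 x; apply/ffunP => b; have := bideg_basis b.
by move=> E; rewrite -E in i0.
Qed.

(** The chain map identity for [phi], before the signs are adjusted. The terms with
    [alpha_l] vanish because [alpha_l] divides [alpha]. *)
Lemma phi_diff k i j (x : F k%:Z) (x' : res_ob R c n i) : i = j + 1 ->
  wedge (wedge alR (res_comp (exp0 c) x))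
    (res_comp (exp0 c) (cxd F i j x' : res_ob R c n j)) top
  = - (-1) ^+ k * wedge (wedge alR
      (res_comp (exp0 c) (cxd F k (k%:Z - 1) x : res_ob R c n (k%:Z - 1))))
      (res_comp (exp0 c) x') top.
Proof.
move=> ij; rewrite !res_comp_diff ?subrK // !res_fullE !alpha_wedge.
set z := res_comp _ x; set z' := res_comp _ x'; set X := iter_wedge aR c z.
have dX : of_degree (c + k)%:Z X.
  by rewrite PoszD; apply: iter_wedge_degree; apply: comp0_degree.
have alX (l : 'I_c) y : wedge X (vec_wedge (aR l) y) = 0.
  rewrite wedge_vec_wedge -vec_wedgeA (invol_degree dX) linearZ /=.
  by rewrite iter_wedge_first // scaler0 wedge0x.
have sum0 (I : finType) (h : I -> ext R n) (y : ext R n) :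
    (forall i, wedge y (h i) = 0) -> wedge y (\sum_i h i) = 0.
  move=> H; elim/big_rec: _ => [|i' w _ E]; first exact: wedgex0.
  by rewrite wedgeDr H E addr0.
rewrite wedgeDr (sum0 _ _ X); last by move=> l; apply: alX.
rewrite addr0 (wedge_koszul_top _ _ dX).
have -> : iter_wedge aR c (koszul_diff fR z + \sum_(l < c)
    vec_wedge (aR l) (res_comp (exp_succ (exp0 c) l) x)) =
  iter_wedge aR c (koszul_diff fR z).
  rewrite -!alpha_wedge wedgeDr (sum0 _ _ alR) ?addr0 // => l.
  by rewrite alpha_wedge iter_wedge_last.
rewrite /X koszul_iter_wedge; last by move=> l; apply: gnatR0.
rewrite wedgeZl [in LHS]ffunE /GRing.scale /=; set W := wedge _ _ _.
transitivity (- ((-1) ^+ c * ((-1) ^+ c * ((-1) ^+ k * W)))).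
  by rewrite exprD; ring.
by rewrite signrMK; ring.
Qed.

(** [(-1)^(i + 1)] is the sign by which the chain map identity fails in degree
    [i]; it is the quotient of the signs in degrees [i] and [i - 1], with period
    four. *)
Definition phi_sign (i : int) : bool := odd (absz i)./2.
Definition signed_phi i j := (-1) ^+ phi_sign i *: phi p f a beta i j.

Lemma phi_signS k : (-1) ^+ phi_sign k.+1 * - (-1) ^+ k.+1
  = (-1) ^+ phi_sign k :> R.
Proof.
rewrite /phi_sign /= uphalf_half oddD oddb signr_addb.
rewrite mulrN exprS mulN1r mulrN opprK mulrAC -[in (-1) ^+ k]signr_odd.
by rewrite -expr2 sqrr_sign mul1r.
Qed.

Lemma signed_phi_chain_map :
  chain_map (D := dual_shift F (n%:Z - c%:Z)) signed_phi.
Proof.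
split=> [||i j ij|i]; first exact: res_complex.
- exact/dual_shift_complex/res_complex.
- by rewrite /signed_phi phi_off_diagonal // scaler0.
apply/lfunP => x; apply/lfunP => x'.
case: i x x' => [k|k] x x'; last first.
  by rewrite (res_neg _ x) // !linear0.
rewrite !comp_lfunE /signed_phi !scale_lfunE.
rewrite [LHS]dual_mapE scale_lfunE !phiE phi_diff; last by lia.
rewrite /GRing.scale /=; case: k x x' => [|k] x x'.
  rewrite (res_neg _ (cxd F 0%Z (0 - 1) x)) //.
  have -> : res_comp (exp0 c) (0 : res_ob R c n (0 - 1)) = 0.
    by apply/ffunP => A; rewrite !ffunE big1 // => b _; rewrite ffunE.
  by rewrite wedgex0 wedge0x ffunE !mulr0.
have -> : phi_sign (k.+1%:Z - 1) = phi_sign k by congr phi_sign; lia.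
by rewrite -[in RHS](phi_signS k); ring.
Qed.

End Comparison.

Lemma ideal_gen_ideal (S : comNzRingType) n (f : 'I_n -> S) : is_ideal (ideal_gen f).
Proof.
split=> [|x y [b ->] [b' ->]|s x [b ->]].
- by exists (fun=> 0); rewrite big1 // => i _; rewrite mul0r.
- exists (fun i => b i + b' i); rewrite -big_split; apply: eq_bigr => i _.
  by rewrite mulrDl.
exists (fun i => s * b i); rewrite mulr_sumr; apply: eq_bigr => i _.
exact: mulrA.
Qed.

(** * phi is a quasi-isomorphism *)

Section Homology.
Variables (S R : comNzRingType) (p : {rmorphism S -> R}) (c n : nat).
Variables (g : 'I_c -> S) (f : 'I_n -> S) (a : 'M[S]_(n, c)).
Hypotheses (hg : regular_sequence g) (hf : regular_sequence f).
Hypothesis p_surj : forall r, exists s, p s = r.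
Hypothesis p_ker : forall s, p s = 0 <-> ideal_gen g s.
Hypothesis ha : forall j, g j = \sum_i a i j * f i.
Variable beta : 'Hom(extpow S n n%:Z, S^o).
Hypothesis hbeta : bijective beta.

Notation fR := (fun i => p (f i)).
Notation aR := (fun l i => p (anat a l i)).
Notation F := (tate_shamash_quot p f a).
Notation T := (dual_shift F (n%:Z - c%:Z)).
Notation alR := (ext_map p (alpha a)).
Notation top := [set: 'I_n].

Lemma ext_map_unstar (x : ext S n) : ext_map p (unstar x) = unstar (ext_map p x).
Proof. by apply/ffunP => A; rewrite !ffunE rmorphM rmorphXn rmorphN1. Qed.

Definition top_sign : S := (-1) ^+ (\sum_(i in top) i)%N.

Lemma dual_generatorE e A : p (dual_generator a e A) =
  if e == exp0 c then p top_sign * wedge alR (ext_delta R A) top else 0.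
Proof.
rewrite /dual_generator /generator; case: ifP => _; last by rewrite ffunE rmorph0.
have E k : ext_map p (gen_coef (fun l => @koszul_diff S n (anat a l))
    (unstar (ext1 S n)) false k) =
  gen_coef (fun l => @koszul_diff R n (aR l)) (unstar (ext1 R n)) false k.
  elim: k => [|k IH] /=; first by rewrite ext_map_unstar ext_map1.
  by rewrite ext_map_koszul IH.
have := congr1 (fun x : ext R n => x A) (E c); rewrite ffunE => ->.
rewrite -pair_delta gen_coef_adjoint -alpha_wedge /pair_ext.
rewrite (bigD1 top) //= big1 => [|B BT]; last first.
  rewrite !ffunE; case: eqP => [E'|_]; last by rewrite mulr0 mul0r.
  by rewrite -[B]setCK E' setC0 eqxx in BT.
by rewrite !ffunE setCT eqxx mulr1 addr0 rmorphXn rmorphN1.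
Qed.

Lemma comp_degree0 (x : F 0) :
  res_comp (exp0 c) x = res_comp (exp0 c) x set0 *: ext1 R n.
Proof.
apply/ffunP => A; rewrite [RHS]ffunE [ext1 _ _ _]ffunE.
case: (eqVneq A set0) => [->|A0]; first by rewrite /GRing.scale /= mulr1.
rewrite scaler0; apply: comp0_degree => -[] /eqP.
by rewrite cards_eq0 (negPf A0).
Qed.

(** [phi] sends [1] in degree [0] to a unit times the generator of the homology of
    the dual. *)
Lemma phi0_delta (x : F 0) b :
  (phi p f a beta 0 0 x : 'Hom(_, R^o)) (res_delta R b) =
  p (beta_unit beta) * res_comp (exp0 c) x set0 * p top_sign
    * p (dual_generator a (res_exp b) (res_set b)).
Proof.
rewrite phiE; move: (comp_degree0 x).
move: (res_comp (exp0 c) x set0) => r E; rewrite {}E.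
rewrite wedgeZr wedgeZl ffunE /GRing.scale /=.
rewrite alpha_wedge dual_generatorE res_comp_delta eq_sym.
case: eqP => _; last by rewrite wedgex0 [X in _ * (_ * X)]ffunE !mulr0.
have -> z : wedge (iter_wedge aR c (ext1 R n)) z = wedge alR z.
  rewrite alpha_wedge /iter_wedge; elim: (iota 0 c) => [|l ls IH] /=.
    exact: wedge1x.
  by rewrite vec_wedgeA IH.
have : p top_sign * p top_sign = 1.
  by rewrite -rmorphM -expr2 sqrr_sign rmorph1.
move: (p top_sign) (wedge _ _ _) => t W tt.
set u := p (beta_unit beta).
by transitivity (u * r * (t * t) * W); [rewrite tt mulr1 mulrA|ring].
Qed.

Lemma dual_eq_basis k (y y' : 'Hom(res_ob R c n k, R^o)) :
  (forall b, y (res_delta R b) = y' (res_delta R b)) -> y = y'.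
Proof. by move=> E; apply: dual_eq; apply/ffunP => b; rewrite !ffunE E. Qed.

Lemma dual_cxdE i j (z : T i) (x : F (n%:Z - c%:Z - j)) :
  (cxd T i j z : 'Hom(_, R^o)) x =
  (z : 'Hom(_, R^o)) (cxd F (n%:Z - c%:Z - j) (n%:Z - c%:Z - i) x).
Proof. exact: dual_mapE. Qed.

Lemma dual_shift_cycle i (y : T i) : Defs.cycle y -> exists s (z : T (i + 1)),
  forall b : res_basis c n (n%:Z - c%:Z - i),
  (y - cxd T (i + 1) i z : 'Hom(_, R^o)) (res_delta R b) =
  p s * p (dual_generator a (res_exp b) (res_set b)).
Proof.
move=> cy; set k := n%:Z - c%:Z - i in y cy *.
have cy' : forall x : F (k + 1), (y : 'Hom(_, R^o)) (cxd F (k + 1) k x) = 0.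
  have : forall x : F (n%:Z - c%:Z - (i - 1)),
    (y : 'Hom(_, R^o)) (cxd F (n%:Z - c%:Z - (i - 1)) k x) = 0.
    by move=> x; rewrite -dual_cxdE cy zero_lfunE.
  have : n%:Z - c%:Z - (i - 1) = k + 1 by rewrite /k; lia.
  by move: (n%:Z - c%:Z - (i - 1)) => k1 ->.
have [s [z E]] := dual_cycle hg hf p_surj p_ker ha cy'; exists s.
have : exists z : 'Hom(res_ob R c n (n%:Z - c%:Z - (i + 1)), R^o),
  forall b : res_basis c n k, (y : 'Hom(_, R^o)) (res_delta R b) =
    p s * p (dual_generator a (res_exp b) (res_set b)) +
    z (cxd F k (n%:Z - c%:Z - (i + 1)) (res_delta R b)).
  have : n%:Z - c%:Z - (i + 1) = k - 1 by rewrite /k; lia.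
  by move: (n%:Z - c%:Z - (i + 1)) => k1 ->; exists z.
move=> [z' E']; exists z' => b; rewrite add_lfunE opp_lfunE E' dual_cxdE.
by rewrite addrK.
Qed.

Lemma exp0_set0_bideg : bideg (exp0 c) (set0 : {set 'I_n}) = 0%N.
Proof. by rewrite /bideg cards0 big1 // => l _; rewrite ffunE. Qed.

Lemma bideg0 e (A : {set 'I_n}) : bideg e A = 0%N -> e = exp0 c /\ A = set0.
Proof.
move=> /eqP; rewrite addn_eq0 muln_eq0 /= cards_eq0 sum_nat_eq0.
move=> /andP[/forallP e0 /eqP->]; split=> //; apply/ffunP => l.
by rewrite ffunE; apply/eqP; apply: e0.
Qed.

Lemma res_exact i (x : F i) : i != 0 -> Defs.cycle x -> boundary x.
Proof.
move=> i0 /(res_cycle hg hf p_surj p_ker ha)[s [y E]]; exists y.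
apply/ffunP => b; rewrite E; case: eqP => [eb|]; last by rewrite mulr0 add0r.
case: eqP => [Ab|]; last by rewrite mulr0 add0r.
by have := bideg_basis b; rewrite eb Ab exp0_set0_bideg => E0; rewrite -E0 in i0.
Qed.

Definition res_unit (r : R) : F 0 := mk_res 0 (fun=> r *: ext1 R n).

Lemma res_unitE r : res_comp (exp0 c) (res_unit r) set0 = r.
Proof.
rewrite res_comp_mk ?exp0_set0_bideg // !ffunE eqxx /GRing.scale /=.
exact: mulr1.
Qed.

Lemma res0_eq (x y : F 0) :
  res_comp (exp0 c) x set0 = res_comp (exp0 c) y set0 -> x = y.
Proof.
move=> E; apply/ffunP => b; have [bd] := bideg_basis b; have [eb Ab] := bideg0 bd.
by rewrite -!res_comp_basis eb Ab.
Qed.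

Lemma res_boundary0 (x : F 0) s : p s = res_comp (exp0 c) x set0 ->
  boundary x <-> ideal_gen f s.
Proof.
move=> ps; split=> [[y yx]|[b sb]].
  move: ps; rewrite -yx res_comp_diff // res_fullE ffunE sum_ffunE [X in _ + X]big1.
    rewrite addr0 koszul_diff0 => ps.
    have [yb ybE] := choice (fun i => p_surj (res_comp (exp0 c) y [set i])).
    have /p_ker gs : p (s - \sum_i yb i * f i) = 0.
      rewrite rmorphB ps rmorph_sum -sumrB big1 // => i _.
      by rewrite rmorphM ybE subrr.
    have [_ JD JM] := ideal_gen_ideal f.
    rewrite -[s](subrK (\sum_i yb i * f i)); apply: JD; last by exists yb.
    have [w ->] := gs; exists (fun i => \sum_l w l * a i l).
    under eq_bigr do rewrite ha mulr_sumr.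
    rewrite exchange_big; apply: eq_bigr => i _; rewrite mulr_suml.
    by apply: eq_bigr => l _; rewrite mulrA.
  by move=> l _; rewrite vec_wedgeE big1 // => i; rewrite inE.
pose h (e : mexp c) := if e == exp0 c then vec_wedge (fun i => p (b i)) (ext1 R n) else 0.
exists (mk_res (0 + 1) h); apply: res0_eq.
rewrite res_comp_diff // (@res_full_local _ _ _ _ _ _ h) => [|e A E]; last first.
  by rewrite res_comp_mk // E exp0_set0_bideg.
rewrite res_fullE ffunE sum_ffunE [X in _ + X]big1 => [|l _]; last first.
  by rewrite vec_wedgeE big1 // => i; rewrite inE.
rewrite addr0 /h eqxx koszul_diff_vec -ps sb !ffunE eqxx rmorph_sum.
by rewrite /GRing.scale /= mulr1; apply: eq_bigr => i _; rewrite rmorphM.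
Qed.

(** Outside degree [0] both complexes are exact. In degree [0] both homology
    groups are [S/J], and [phi] is multiplication by a unit. *)
Lemma signed_phi_quasi_iso i :
  @iso_on_homology R F T (signed_phi p f a beta) i.
Proof.
have [i0|i0] := eqVneq i 0; last first.
  split=> [x cx _|y cy]; first exact: res_exact.
  exists 0; split; first by rewrite /Defs.cycle linear0.
  have [s [z E]] := dual_shift_cycle cy; exists z; rewrite linear0 subr0.
  apply/esym/eqP; rewrite -subr_eq0; apply/eqP; apply: dual_eq_basis => b.
  rewrite E zero_lfunE dual_generator_degree ?rmorph0 ?mulr0 //.
  by apply: contraNneq i0 => En; have := bideg_basis b; move: En; lia.
have [u uK] := beta_unit_inv hbeta; rewrite i0; split=> [x _ [y E]|y cy].
  have [s ps] := p_surj (res_comp (exp0 c) x set0).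
  pose k := (-1) ^+ phi_sign 0 * (beta_unit beta * top_sign).
  apply/(res_boundary0 ps).
  have -> : s = (-1) ^+ phi_sign 0 * (u * top_sign) * (k * s).
    rewrite /k; set e := (-1) ^+ _; set t := top_sign.
    have ee : e * e = 1 by rewrite -expr2 sqrr_sign.
    have tt : t * t = 1 by rewrite -expr2 sqrr_sign.
    transitivity ((e * e) * (t * t) * (u * beta_unit beta) * s); last by ring.
    by rewrite ee tt uK !mul1r.
  have [_ _ JM] := ideal_gen_ideal f; apply: JM.
  have : exists y' : 'Hom(res_ob R c n (n%:Z - c%:Z - (0 + 1)), R^o),
      forall b : res_basis c n (n%:Z - c%:Z - 0),
      p (k * s) * p (dual_generator a (res_exp b) (res_set b)) =
      y' (cxd F (n%:Z - c%:Z - 0) (n%:Z - c%:Z - (0 + 1)) (res_delta R b)).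
    exists y => b; rewrite -dual_cxdE E /signed_phi 2!scale_lfunE phi0_delta -ps.
    rewrite /k !rmorphM rmorphXn rmorphN1 /GRing.scale /=; ring.
  have -> : n%:Z - c%:Z - 0 = n%:Z - c%:Z by lia.
  have -> : n%:Z - c%:Z - (0 + 1) = n%:Z - c%:Z - 1 by lia.
  by move=> [y' E']; apply: (dual_augment hg p_surj p_ker ha E').
have [s [z E]] := dual_shift_cycle cy.
pose k := (-1) ^+ phi_sign 0 * (u * top_sign).
exists (res_unit (p (k * s))); split.
  by apply: res_neg.
exists z; apply/esym/eqP; rewrite -subr_eq0 addrAC; apply/eqP.
apply: dual_eq_basis => b.
rewrite add_lfunE E opp_lfunE /signed_phi 2!scale_lfunE phi0_delta.
rewrite res_unitE zero_lfunE; apply/eqP; rewrite subr_eq0; apply/eqP.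
rewrite /GRing.scale /= -(rmorphN1 p) -rmorphXn -!rmorphM; congr (p _).
rewrite /k; set e := (-1) ^+ _; set t := top_sign; set w := dual_generator _ _ _.
have ee : e * e = 1 by rewrite -expr2 sqrr_sign.
have tt : t * t = 1 by rewrite -expr2 sqrr_sign.
transitivity ((e * e) * (t * t) * (u * beta_unit beta) * s * w); last by ring.
by rewrite ee tt uK !mul1r.
Qed.

End Homology.

(** * Maximal ideals and minimality *)

Section Ideals.
Variable S : comNzRingType.
Implicit Types (I m K : S -> Prop).

Lemma ideal_sum I (T : Type) (r : seq T) (P : pred T) (F : T -> S) : is_ideal I ->
  (forall i, P i -> I (F i)) -> I (\sum_(i <- r | P i) F i).
Proof. by move=> [I0 ID _] IF; elim/big_ind: _. Qed.

Lemma proper_sub_maximal I : is_ideal I -> ~ I 1 ->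
  exists m, maximal_ideal m /\ forall s, I s -> m s.
Proof.
move=> Iid I1; pose T := {K | [/\ is_ideal K, ~ K 1 & forall s, I s -> K s]}.
pose t0 : T := exist _ I (And3 Iid I1 (fun s h => h)).
pose le (K K' : T) : bool := `[< forall s, sval K s -> sval K' s >].
have [||A Atot|[m [mid m1 Im]] mmax] := @classical_sets.ZL_preorder T t0 le.
- by move=> K; apply/asboolP.
- move=> K K' K'' /asboolP h /asboolP h'; apply/asboolP => s Ks.
  by apply: h'; apply: h.
- have [[K AK]|A0] := pselect (exists K : T, A K); last first.
    by exists t0 => K AK; case: A0; exists K.
  pose U s := exists K : T, A K /\ sval K s.
  have Uid : is_ideal U.
    split=> [|x y [K1 [A1 Kx]] [K2 [A2 Ky]]|s x [K1 [A1 Kx]]].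
    - by exists K; split=> //; case: (svalP K) => -[].
    - have [/asboolP h|/asboolP h] := Atot _ _ A1 A2.
        exists K2; split=> //; case: (svalP K2) => -[_ KD _] _ _.
        by apply: KD => //; apply: h.
      exists K1; split=> //; case: (svalP K1) => -[_ KD _] _ _.
      by apply: KD => //; apply: h.
    by exists K1; split=> //; case: (svalP K1) => -[_ _ KM] _ _; apply: KM.
  have U1 : ~ U 1 by move=> [K1 [_]]; case: (svalP K1).
  have IU s : I s -> U s.
    by move=> Is; exists K; split=> //; case: (svalP K) => _ _; apply.
  exists (exist _ U (And3 Uid U1 IU)) => K' AK'; apply/asboolP => s Ks.
  by exists K'.
exists m; split=> //; split=> // K Kid K1 mK s Ks.
have IK s' : I s' -> K s' by move=> /Im/mK.
have /asboolP := mmax (exist _ K (And3 Kid K1 IK)) (introT (asboolP _) mK).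
exact.
Qed.

Lemma proper_sub_local m I : local_with m -> is_ideal I -> ~ I 1 ->
  forall s, I s -> m s.
Proof.
move=> [_ muniq] Iid I1; have [m' [m'max Im']] := proper_sub_maximal Iid I1.
by move=> s /Im' /(muniq _ m'max).
Qed.

Variables (R : comNzRingType) (p : {rmorphism S -> R}).
Hypothesis p_surj : forall r, exists s, p s = r.

(** Ideals of [R] correspond to the ideals of [S] that contain the kernel. *)
Lemma local_image m : local_with m -> (forall s, p s = 0 -> m s) ->
  local_with (fun r => exists s, m s /\ p s = r).
Proof.
move=> [[[m0 mD mM] m1 mmax] muniq] kerm.
have pre (K : R -> Prop) : is_ideal K -> is_ideal (fun s => K (p s)).
  move=> [K0 KD KM]; split=> [|x y Kx Ky|s x Kx].
  - by rewrite rmorph0.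
  - by rewrite rmorphD; apply: KD.
  by rewrite rmorphM; apply: KM.
have im (K : S -> Prop) : is_ideal K -> is_ideal (fun r => exists s, K s /\ p s = r).
  move=> [K0 KD KM]; split=> [|_ _ [x [Kx <-]] [y [Ky <-]]|r _ [x [Kx <-]]].
  - by exists 0; rewrite rmorph0.
  - by exists (x + y); rewrite rmorphD; split=> //; apply: KD.
  by have [s <-] := p_surj r; exists (s * x); rewrite rmorphM; split=> //; apply: KM.
have lift1 (K : S -> Prop) : is_ideal K -> (forall s, p s = 0 -> K s) ->
    (exists s, K s /\ p s = 1) -> K 1.
  move=> [_ KD KM] kerK [s [Ks ps]]; rewrite -[1](subrK s); apply: KD => //.
  by apply: kerK; rewrite rmorphB rmorph1 ps subrr.
split.
  split; first exact: im.
    by move=> /(lift1 m (And3 m0 mD mM) kerm).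
  move=> K Kid K1 mK r Kr; have [s ps] := p_surj r; exists s; split=> //.
  apply: (mmax (fun s => K (p s))); rewrite ?rmorph1 ?ps //; first exact: pre.
  by move=> s' ms'; apply: mK; exists s'.
move=> m' [m'id m'1 m'max] r.
have pmax : maximal_ideal (fun s => m' (p s)).
  split; [exact: pre|by rewrite rmorph1|move=> K Kid K1 mK s Ks].
  have kerK s' : p s' = 0 -> K s'.
    by move=> ps; apply: mK; rewrite ps; case: m'id.
  apply: (m'max (fun r => exists s, K s /\ p s = r)); [exact: im| | |by exists s].
    by move=> /(lift1 K Kid kerK).
  move=> r' mr'; have [s' ps'] := p_surj r'; exists s'; split=> //.
  by apply: mK; rewrite ps'.
have E := muniq _ pmax; split=> [mr|[s [ms <-]]]; last exact/E.
by have [s ps] := p_surj r; exists s; split=> //; apply/E; rewrite ps.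
Qed.

End Ideals.

Section Minimality.
Variables (R : comNzRingType) (m : R -> Prop).
Hypothesis mid : is_ideal m.
Let m0 : m 0. Proof. by case: mid. Qed.
Let mD x y : m x -> m y -> m (x + y). Proof. by case: mid => _ h _; apply: h. Qed.
Let mM x y : m y -> m (x * y). Proof. by case: mid => _ _; apply. Qed.
Let mMr x y : m x -> m (x * y). Proof. by rewrite mulrC; apply: mM. Qed.

Definition ext_in_ideal n (x : ext R n) := forall A, m (x A).

Lemma vec_wedge_in n (v : 'I_n -> R) x : (forall i, m (v i)) ->
  ext_in_ideal (vec_wedge v x).
Proof.
move=> mv A; rewrite vec_wedgeE; apply: ideal_sum => // i _.
by apply: mM; apply: mMr.
Qed.

Lemma koszul_diff_in n (v : 'I_n -> R) x : (forall i, m (v i)) ->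
  ext_in_ideal (koszul_diff v x).
Proof.
move=> mv A; rewrite koszul_diffE; apply: ideal_sum => // i _.
by apply: mM; apply: mMr.
Qed.

Lemma wedge_in n (x y : ext R n) : ext_in_ideal x -> ext_in_ideal (wedge x y).
Proof.
move=> mx A; rewrite ffunE; apply: ideal_sum => // B _.
by apply: mM; apply: mMr.
Qed.

Lemma iter_wedge_in n (av : nat -> 'I_n -> R) k x : (0 < k)%N ->
  (forall l i, m (av l i)) -> ext_in_ideal (iter_wedge av k x).
Proof. by case: k => // k _ mav; apply: vec_wedge_in. Qed.

Lemma res_full_in c n (f : 'I_n -> R) av (u : mexp c -> ext R n) e A :
  (forall i, m (f i)) -> (forall l i, m (av l i)) -> m (res_full f av u e A).
Proof.
move=> mf mav; rewrite res_fullE ffunE sum_ffunE; apply: mD.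
  exact: koszul_diff_in.
by apply: ideal_sum => // l _; apply: vec_wedge_in.
Qed.

End Minimality.

Section PairSums.
Variables (R : comNzRingType) (V W : vectType R) (I : finType) (k : I -> R).

Lemma sum_pairl (x : I -> V) :
  ((\sum_i k i *: x i, 0) : dsum V W) = \sum_i k i *: ((x i, 0) : dsum V W).
Proof.
elim/big_rec2: _ => // i y1 y2 _ <-; congr (_, _).
by rewrite /= scaler0 addr0.
Qed.

Lemma sum_pairr (y : I -> W) :
  ((0, \sum_i k i *: y i) : dsum V W) = \sum_i k i *: ((0, y i) : dsum V W).
Proof.
elim/big_rec2: _ => // i y1 y2 _ <-; congr (_, _).
by rewrite /= scaler0 addr0.
Qed.
End PairSums.

Section Minimal.
Variables (S R : comNzRingType) (p : {rmorphism S -> R}) (c n : nat).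
Variables (f : 'I_n -> S) (a : 'M[S]_(n, c)).
Variable beta : 'Hom(extpow S n n%:Z, S^o).
Hypothesis hc : (0 < c)%N.
Variable m : R -> Prop.
Hypothesis mid : is_ideal m.
Hypotheses (mf : forall i, m (p (f i))) (ma : forall i l, m (p (a i l))).

Notation F := (tate_shamash_quot p f a).
Notation T := (dual_shift F (n%:Z - c%:Z)).
Notation psi := (signed_phi p f a beta).

Lemma anat_in l i : m (p (anat a l i)).
Proof.
rewrite /anat; case: insub => [l'|]; first exact: ma.
by rewrite rmorph0; case: mid.
Qed.

Lemma res_diff_in i j (x : F i) b : m ((cxd F i j x : res_ob R c n j) b).
Proof. by rewrite resE; apply: res_full_in => // l k; apply: anat_in. Qed.

Lemma hom_in k (y : 'Hom(res_ob R c n k, R^o)) (x : res_ob R c n k) :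
  (forall b, m (x b)) -> m (y x).
Proof.
move=> mx; rewrite dual_coordsE; apply: ideal_sum => // b _.
by case: mid => _ _; apply.
Qed.

Lemma mk_dual_delta k (b b' : res_basis c n k) :
  mk_dual (res_delta R b) (res_delta R b') = (b == b')%:R.
Proof.
have := congr1 (fun z : res_ob R c n k => z b') (mk_dualK (res_delta R b)).
by rewrite [X in X = _]ffunE res_delta_at (eq_sym b) => ->.
Qed.

Lemma res_dual_delta k (y : 'Hom(res_ob R c n k, R^o)) :
  y = \sum_b y (res_delta R b) *: mk_dual (res_delta R b).
Proof.
apply: dual_eq_basis => b; rewrite sum_lfunE.
under eq_bigr do rewrite scale_lfunE mk_dual_delta.
rewrite (bigD1 b) //= big1 => [|b' /negPf->]; last exact: scaler0.
by rewrite eqxx addr0 /GRing.scale /= mulr1.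
Qed.

(** [iter_wedge_in] uses a factor of [alpha], which exists because [c > 0]. *)
Lemma cone_minimal : minimal_complex m (cone (D := T) psi).
Proof.
move=> i [x y].
pose k := n%:Z - c%:Z - (i - 1 + 1).
pose X : F (i - 1) := cxd F i (i - 1) x.
pose Y : 'Hom(res_ob R c n k, R^o) := psi i (i - 1 + 1) x - cxd T (i + 1) (i - 1 + 1) y.
pose B := (res_basis c n (i - 1) + res_basis c n k)%type.
pose r (t : B) : R := match t with inl b => (X : res_ob R c n (i - 1)) b
  | inr b => Y (res_delta R b) end.
pose v (t : B) : cone (D := T) psi (i - 1) := match t with
  | inl b => (res_delta R b : F (i - 1), 0 : T (i - 1 + 1))
  | inr b => (0 : F (i - 1), mk_dual (res_delta R b) : T (i - 1 + 1)) end.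
exists #|{: B}|, (fun l => r (enum_val l)), (fun l => v (enum_val l)); split.
  move=> l; case: (enum_val l) => b /=; first exact: res_diff_in.
  have mD u w : m u -> m w -> m (u + w) by case: mid => _ h _; apply: h.
  have mM u w : m w -> m (u * w) by case: mid => _ _; apply.
  have mN u : m u -> m (- u) by rewrite -mulN1r; apply: (mM).
  rewrite /Y add_lfunE opp_lfunE; apply: (mD).
    rewrite /signed_phi 2!scale_lfunE /GRing.scale /=; apply: (mM).
    rewrite phiE; apply: (mM); apply: (wedge_in mid) => A; rewrite alpha_wedge.
    apply: (iter_wedge_in mid _ hc) => l' i'; exact: anat_in.
  apply: mN; rewrite dual_cxdE; apply: hom_in => b'.
  exact: res_diff_in.
transitivity ((X, Y) : cone (D := T) psi (i - 1)); first exact: cone_mapE.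
rewrite -(big_enum_val (A := {: B}) (fun t => r t *: v t)) /= big_sumType /=.
rewrite {1}(res_deltaE X) {1}(res_dual_delta Y).
transitivity ((\sum_b (X : res_ob R c n (i - 1)) b *: res_delta R b : F (i - 1),
    0 : T (i - 1 + 1))
  + (0 : F (i - 1), \sum_b Y (res_delta R b) *: mk_dual (res_delta R b) : T (i - 1 + 1))
   : cone (D := T) psi (i - 1)).
  by congr (_, _); rewrite /= ?addr0 ?add0r.
by congr (_ + _); [exact: sum_pairl|exact: sum_pairr].
Qed.
End Minimal.

(** * The Tate resolution *)

Section Augmentation.
Variables (S R : comNzRingType) (p : {rmorphism S -> R}) (c n : nat).
Variables (f : 'I_n -> S) (a : 'M[S]_(n, c)) (M : lmodType R) (m0 : M).
Notation F := (tate_shamash_quot p f a).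

Definition res_augment (x : F 0) : M := res_comp (exp0 c) x set0 *: m0.

Lemma res_augment_linear : linear res_augment.
Proof.
move=> k x y; rewrite /res_augment res_comp_linear !ffunE scalerDl.
by rewrite [k *: _]/(_ *: _) /= -scalerA.
Qed.
HB.instance Definition _ :=
  GRing.isLinear.Build R _ _ _ res_augment res_augment_linear.
End Augmentation.

(** Writing the combination with coefficients [w i] in [m] as well gives a relation
    between the [f i], with coefficients in [J] by [regular_relation]. *)
Lemma coef_in_maximal (S : comNzRingType) (n : nat) (f : 'I_n -> S) (b : 'I_n -> S)
    (m : S -> Prop) : regular_sequence f -> is_ideal m ->
  (forall s, ideal_gen f s -> m s) -> ideal_mul m (ideal_gen f) (\sum_i b i * f i) ->
  forall i, m (b i).
Proof.
move=> hf mid Jm [k [x [y [mx Jy E]]]] i.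
have [_ mD mM] := mid; have [z zE] := choice Jy.
pose w i := \sum_t x t * z t i.
rewrite -[b i](subrK (w i)); apply: mD; last first.
  by apply: ideal_sum => // t _; rewrite mulrC; apply: mM.
apply: Jm; apply: (regular_relation hf (b := fun i => b i - w i)).
under eq_bigr do rewrite mulrBl.
rewrite sumrB E; apply/eqP; rewrite subr_eq0; apply/eqP.
transitivity (\sum_t \sum_i x t * (z t i * f i)).
  by apply: eq_bigr => t _; rewrite {1}zE mulr_sumr.
rewrite exchange_big; apply: eq_bigr => j _; rewrite /w mulr_suml.
by apply: eq_bigr => t _; rewrite mulrA.
Qed.

Theorem theorem2p2 (S : comNzRingType) (hS : gorenstein S)
    (c n : nat) (hc : (0 < c)%N) (g : 'I_c -> S) (f : 'I_n -> S)
    (hIJ : forall s, ideal_gen g s -> ideal_gen f s)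
    (hg : regular_sequence g) (hf : regular_sequence f)
    (* R = S/I *)
    (R : comNzRingType) (p : {rmorphism S -> R})
    (p_surj : forall r, exists s, p s = r)
    (p_ker : forall s, p s = 0 <-> ideal_gen g s)
    (* M = S/J *)
    (M : lmodType R) (q : {linear S^o -> M | p \; *:%R})
    (q_surj : forall m, exists s : S, q s = m)
    (q_ker : forall s : S, q s = 0 <-> ideal_gen f s)
    (a : 'M[S]_(n, c)) (ha : forall j, g j = \sum_i a i j * f i)
    (beta : 'Hom(extpow S n n%:Z, S^o)) (hbeta : bijective beta) :
  let F := tate_shamash_quot p f a in
  let T := dual_shift F (n%:Z - c%:Z) in
  (* M = H_0(F) *)
  (exists eps : {linear F 0 -> M},
     (forall x : F 0, eps x = res_comp [ffun=> 0%N] x set0 *: q 1) /\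
     free_resolution eps) /\
  exists sgn : int -> bool,
    let psi := fun i j => (-1) ^+ sgn i *: phi p f a beta i j in
    [/\ @chain_map R F T psi,
        @iso_on_homology R F T psi 0,
        tate_resolution (cone (D := T) psi) M &
        forall m : S -> Prop, local_with m ->
          (forall s, ideal_gen g s -> ideal_mul m (ideal_gen f) s) ->
          exists mR : R -> Prop,
            local_with mR /\ minimal_complex mR (cone (D := T) psi)].
Proof.
move=> F T.
have hp : forall s, p s = 0 -> ideal_gen f s by move=> s /p_ker /hIJ.
have qE (r : R) s : p s = r -> r *: q 1 = q s.
  move=> <-; have := linearZ_LR q s 1; rewrite /= => <-; congr (q _).
  exact: mulr1.
have augE (x : F 0) : res_augment (q 1) x = 0 <-> boundary x.
  have [s ps] := p_surj (res_comp (exp0 c) x set0).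
  rewrite /res_augment (qE _ _ ps) q_ker.
  by split=> /(res_boundary0 p_surj p_ker ha ps).
have Fres : free_resolution (res_augment (q 1) : {linear F 0 -> M}).
  split=> [|i i0 x|i i0|m|x].
  - exact: res_complex p_ker ha.
  - exact: res_neg.
  - move=> x; split; last first.
      by move=> bx; apply: boundary_cycle bx; exact: res_complex p_ker ha.
    by apply: (res_exact hg hf p_surj p_ker ha); rewrite gt_eqF.
  - have [s <-] := q_surj m; exists (res_unit p f a (p s)).
    by rewrite /= /res_augment res_unitE; apply: qE.
  exact: augE.
split; first by exists (res_augment (q 1)).
exists phi_sign => psi'.
have chain : @chain_map R F T (signed_phi p f a beta) by apply: signed_phi_chain_map p_ker ha _.
have iso i : @iso_on_homology R F T (signed_phi p f a beta) i.
  by apply: (signed_phi_quasi_iso hg hf p_surj p_ker ha hbeta).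
split=> //.
  apply: (cone_tate (N := n%:Z + 1) chain iso Fres) => i Ni y.
  apply/lfunP => x; rewrite zero_lfunE (res_neg (p := p) (f := f) (a := a) _ x).
    exact: linear0.
  by lia.
move=> m mloc Im; have [mmax _] := mloc; have [mid m1 _] := mmax.
have Jm s : ideal_gen f s -> m s.
  apply: proper_sub_local => //; [exact: ideal_gen_ideal|exact: (proj1 hf)].
have am i l : m (a i l).
  apply: (coef_in_maximal hf mid Jm (b := fun i => a i l)).
  rewrite -ha; apply: Im; exists (fun k => (k == l)%:R).
  by rewrite (bigD1 l) //= eqxx mul1r big1 ?addr0 // => k /negPf->; rewrite mul0r.
have mRloc := local_image p_surj mloc (fun s ps => Jm s (hp s ps)).
exists (fun r => exists s, m s /\ p s = r); split=> //.
have [[mRid _ _] _] := mRloc.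
apply: cone_minimal => // [i|i l]; last by exists (a i l).
exists (f i); split=> //; apply: Jm; exists (fun k => (k == i)%:R).
by rewrite (bigD1 i) //= eqxx mul1r big1 ?addr0 // => k /negPf->; rewrite mul0r.
Qed.
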